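(* For all integers $k\geq 3$ and $n\geq 3$, $$R(\mathcal{P}^k_n,\mathcal{P}^k_3)=R(\mathcal{P}^k_n,\mathcal{C}^k_3)=R(\mathcal{C}^k_n,\mathcal{C}^k_3)+1=(k-1)n+2 .$$
   Context: For $k$-uniform hypergraphs $\mathcal{G},\mathcal{H}$, the Ramsey number $R(\mathcal{G},\mathcal{H})$ is the smallest integer $N$ such that every red-blue coloring of the edges of the complete $k$-uniform hypergraph $\mathcal{K}^k_N$ on $N$ vertices contains a red copy of $\mathcal{G}$ or a blue copy of $\mathcal{H}$ (copies are sub-hypergraphs, not necessarily induced). The $k$-uniform loose cycle $\mathcal{C}^k_n$ (cycle of length $n$) has vertex set $\{v_1,\ldots,v_{n(k-1)}\}$ and the $n$ edges $e_i=\{v_{(i-1)(k-1)+1},v_{(i-1)(k-1)+2},\ldots,v_{i(k-1)+1}\}$, $i=1,\ldots,n$, with subscripts taken mod $n(k-1)$. The $k$-uniform loose path $\mathcal{P}^k_n$ (path of length $n$) has vertex set $\{v_1,\ldots,v_{n(k-1)+1}\}$ and the $n$ edges $e_i=\{v_{(i-1)(k-1)+1},\ldots,v_{i(k-1)+1}\}$, $i=1,\ldots,n$ (no reduction of subscripts). *)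

(* Defs.v *)
From mathcomp Require Import all_boot.

Set Implicit Arguments.
Unset Strict Implicit.
Unset Printing Implicit Defensive.

Record hypergraph := Hypergraph {
  vertex : finType;
  edges : {set {set vertex}}
}.

Definition uniform (k : nat) (G : hypergraph) : bool :=
  [forall e in edges G, #|e| == k].

Definition complete_hypergraph (k N : nat) : hypergraph :=
  @Hypergraph 'I_N [set e : {set 'I_N} | #|e| == k].

(* Sub-hypergraph containment, not necessarily induced. *)
Definition contains_copy (H G : hypergraph) : Prop :=
  exists2 f : vertex G -> vertex H,
    injective f & forall e, e \in edges G -> f @: e \in edges H.

(* The spanning sub-hypergraph of H whose edges have colour b; the values of
   the colouring c on non-edges of H play no role. *)
Definition colour_class (H : hypergraph) (c : {set vertex H} -> bool)
    (b : bool) : hypergraph :=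
  @Hypergraph (vertex H) [set e in edges H | c e == b].

(* Red is true, blue is false. *)
Definition arrows (k N : nat) (G H : hypergraph) : Prop :=
  forall c : {set vertex (complete_hypergraph k N)} -> bool,
    contains_copy (colour_class c true) G \/
    contains_copy (colour_class c false) H.

(* R(G, H) = N for k-uniform G and H. *)
Definition is_ramsey_number (k : nat) (G H : hypergraph) (N : nat) : Prop :=
  arrows k N G H /\ forall M, arrows k M G H -> N <= M.

(* Vertices and edges are indexed from 0: v_(j+1) is j and e_(i+1) is the edge
   of index i. *)
Definition loose_path_edge (k n : nat) (i : 'I_n) : {set 'I_(n * k.-1).+1} :=
  [set v : 'I_(n * k.-1).+1 | i * k.-1 <= v <= i.+1 * k.-1].

Definition loose_path (k n : nat) : hypergraph :=
  @Hypergraph 'I_(n * k.-1).+1 [set loose_path_edge k i | i : 'I_n].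

Definition loose_cycle_edge (k n : nat) (i : 'I_n) : {set 'I_(n * k.-1)} :=
  [set v : 'I_(n * k.-1) |
    [exists j : 'I_k, val v == (i * k.-1 + j) %% (n * k.-1)]].

Definition loose_cycle (k n : nat) : hypergraph :=
  @Hypergraph 'I_(n * k.-1) [set loose_cycle_edge k i | i : 'I_n].

Lemma loose_path_uniform (k n : nat) : 0 < k -> uniform k (loose_path k n).
Proof.
case: k => // k _; apply/forall_inP => /= _ /imsetP[i _ ->].
have bnd (j : 'I_k.+1) : i * k + j < (n * k).+1.
  rewrite ltnS (@leq_trans (i.+1 * k)) ?leq_mul2r ?ltn_ord ?orbT //.
  by rewrite mulSn addnC leq_add2r -ltnS.
pose h j := Ordinal (bnd j).
have h_inj : injective h.
  by move=> a b /(congr1 val) /= /addnI ab; apply: val_inj.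
suff -> : loose_path_edge k.+1 i = h @: 'I_k.+1 by rewrite card_imset ?card_ord.
apply/setP => v; rewrite inE /=; apply/idP/imsetP => [/andP[iv vi]|[j _ ->]] /=.
  have vk : v - i * k < k.+1 by rewrite ltnS leq_subLR addnC -mulSn.
  by exists (Ordinal vk) => //; apply: val_inj; rewrite /= subnKC.
by rewrite leq_addr mulSn addnC leq_add2r -ltnS /=.
Qed.

Lemma loose_cycle_uniform (k n : nat) :
  1 < k -> 1 < n -> uniform k (loose_cycle k n).
Proof.
case: k => [|[|k]] // _ n_gt1; apply/forall_inP => /= _ /imsetP[i _ ->].
set m := n * k.+1; have km : k.+2 <= m.
  by apply: (@leq_trans (2 * k.+1)); rewrite ?leq_mul2r ?n_gt1 ?orbT // mul2n
    -addnn addSn !ltnS leq_addl.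
have m_gt0 : 0 < m by apply: leq_trans km.
pose h (j : 'I_k.+2) := Ordinal (ltn_pmod (i * k.+1 + j) m_gt0).
have h_inj : injective h.
  move=> a b /(congr1 val) /= /eqP; rewrite eqn_modDl.
  by rewrite !modn_small ?(leq_trans (ltn_ord _) km) // => /eqP; apply: val_inj.
suff -> : loose_cycle_edge k.+2 i = h @: 'I_k.+2.
  by rewrite card_imset ?card_ord.
apply/setP => v; rewrite inE; apply/existsP/imsetP => [[j /eqP vj]|[j _ ->]].
  by exists j => //; apply: val_inj.
by exists j.
Qed.

(* Main.v *)
(* Write s = k - 1. The lower bounds come from colouring red the edges that miss
   one fixed vertex.

   For the upper bound on R(C_n, C_3), induct on n. Take a red edge K + a and a
   blue edge K + d that share s vertices, and let O be the set of all other
   vertices. If some p in K and some s-set X in O span a blue edge, then q + Y is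
   red for every q <> p in K and every s-set Y in O that meets X in one vertex,
   since otherwise there is a blue triangle with K + d. In either case there are
   many red edges q + Y, and two of them with distinct q, r in K join K + a to the
   ends of a red path in O + d that is provided by induction, closing a red C_n.
   The cases n = 3, 4, 5, where this path has fewer than three edges, use
   extremal choices instead, and s = 2 is treated apart because K then has only
   two elements.

   A red C_n and two further vertices give a red P_n or a blue C_3, and a blue
   C_3 without a blue P_3 forces so many red edges around it that a red P_n can
   be threaded through it. *)

Require Import Defs.
From mathcomp Require Import all_boot.
From mathcomp Require Import zify.
From Stdlib Require Import Classical_Prop.

Set Implicit Arguments.
Unset Strict Implicit.
Unset Printing Implicit Defensive.

(** * Deciding set goals pointwise *)

Lemma imp_elim (a b : bool) : a -> (a ==> b) -> b.
Proof. by move=> ->. Qed.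

Section Pointwise.
Variable T : finType.
Implicit Types (A B : {set T}) (t x y : T).

Lemma pw_sub t A B : A \subset B -> (t \in A) ==> (t \in B).
Proof. by move/subsetP/(_ t)/implyP. Qed.

Lemma pw_dis t A B : [disjoint A & B] -> (t \in A) ==> (t \notin B).
Proof. by move=> dAB; apply/implyP => /(disjointFr dAB) ->. Qed.

Lemma pw_eq t A B : A = B -> (t \in A) == (t \in B).
Proof. by move=> ->. Qed.

Lemma pw_in t x A : x \in A -> (t == x) ==> (t \in A).
Proof. by move=> xA; apply/implyP => /eqP ->. Qed.

Lemma pw_notin t x A : x \notin A -> (t == x) ==> (t \notin A).
Proof. by move=> xA; apply/implyP => /eqP ->. Qed.

Lemma pw_neq t x y : x != y -> (t == x) ==> (t != y).
Proof. by move=> xy; apply/implyP => /eqP ->. Qed.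

Lemma sub_pw A B : (forall t, (t \in A) ==> (t \in B)) -> A \subset B.
Proof. by move=> h; apply/subsetP => t; apply/implyP. Qed.

Lemma dis_pw A B : (forall t, (t \in A) ==> (t \notin B)) -> [disjoint A & B].
Proof.
move=> h; rewrite -setI_eq0; apply/eqP/setP => t; rewrite !inE.
by have:= h t; case: (t \in A) => //= /negbTE.
Qed.

Lemma eq_pw A B : (forall t, (t \in A) == (t \in B)) -> A = B.
Proof. by move=> h; apply/setP => t; apply/eqP. Qed.

Lemma in_pw x A : (forall t, (t == x) ==> (t \in A)) -> x \in A.
Proof. by move/(_ x); rewrite eqxx. Qed.

Lemma notin_pw x A : (forall t, (t == x) ==> (t \notin A)) -> x \notin A.
Proof. by move/(_ x); rewrite eqxx. Qed.

Lemma neq_pw x y : (forall t, (t == x) ==> (t != y)) -> x != y.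
Proof. by move/(_ x); rewrite eqxx. Qed.

End Pointwise.

Ltac pw_goal :=
  lazymatch goal with
  | |- is_true (subset _ _) => apply: sub_pw
  | |- is_true (disjoint _ _) => apply: dis_pw
  | |- @eq {set _} _ _ => apply: eq_pw
  | |- is_true (~~ (_ == _)) => apply: neq_pw
  | |- is_true (~~ (in_mem _ _)) => apply: notin_pw
  | |- is_true (in_mem _ _) => apply: in_pw
  end.

(** Boolean goals are reified into this type, so that [vm_compute] can decide them by a DPLL search
    proved sound below. *)
Inductive form :=
  | Cst of bool | Atom of nat | Not of form
  | And of form & form | Or of form & form | Imp of form & form | Iff of form & form.

Fixpoint form_eval (v : nat -> bool) f :=
  match f with
  | Cst b => b
  | Atom n => v n
  | Not f => ~~ form_eval v f
  | And f g => form_eval v f && form_eval v g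
  | Or f g => form_eval v f || form_eval v g
  | Imp f g => form_eval v f ==> form_eval v g
  | Iff f g => form_eval v f == form_eval v g
  end.

(** Negated disjunctions and implications become conjunctions, whose literals [form_unit] can then
    find. *)
Fixpoint mkNot f :=
  match f with
  | Cst b => Cst (~~ b)
  | Not g => g
  | Or g h => And (mkNot g) (mkNot h)
  | Imp g h => And g (mkNot h)
  | _ => Not f
  end.

Definition mkAnd f g :=
  match f, g with
  | Cst b, _ => if b then g else Cst false
  | _, Cst b => if b then f else Cst false
  | _, _ => And f g
  end.

Definition mkOr f g :=
  match f, g with
  | Cst b, _ => if b then Cst true else g
  | _, Cst b => if b then Cst true else f
  | _, _ => Or f g
  end.

Definition mkImp f g :=
  match f, g with
  | Cst b, _ => if b then g else Cst true
  | _, Cst b => if b then Cst true else mkNot f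
  | _, _ => Imp f g
  end.

Definition mkIff f g :=
  match f, g with
  | Cst b, _ => if b then g else mkNot g
  | _, Cst b => if b then f else mkNot f
  | _, _ => Iff f g
  end.

Fixpoint form_set n b f :=
  match f with
  | Cst _ => f
  | Atom m => if eqn m n then Cst b else f
  | Not f => mkNot (form_set n b f)
  | And f g => mkAnd (form_set n b f) (form_set n b g)
  | Or f g => mkOr (form_set n b f) (form_set n b g)
  | Imp f g => mkImp (form_set n b f) (form_set n b g)
  | Iff f g => mkIff (form_set n b f) (form_set n b g)
  end.

Fixpoint form_unit f :=
  match f with
  | Atom n => Some (n, true)
  | Not (Atom n) => Some (n, false)
  | And f g => if form_unit f is Some l then Some l else form_unit g
  | _ => None
  end.

Fixpoint form_atom f :=
  match f with
  | Cst _ => None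
  | Atom n => Some n
  | Not f => form_atom f
  | And f g | Or f g | Imp f g | Iff f g =>
      if form_atom f is Some n then Some n else form_atom g
  end.

(** A forced literal is propagated before any case split. [k] is fuel; when it runs out the answer
    is [false], which asserts nothing. *)
Fixpoint form_unsat k f :=
  if k is k'.+1 then
    if f is Cst b then ~~ b else
    match form_unit f, form_atom f with
    | Some (n, b), _ => form_unsat k' (form_set n b f)
    | _, Some n =>
        form_unsat k' (form_set n true f) && form_unsat k' (form_set n false f)
    | _, _ => false
    end
  else false.

Section FormSound.
Variable v : nat -> bool.
Local Notation ev := (form_eval v).

Lemma mkNotE f : ev (mkNot f) = ~~ ev f.
Proof.
elim: f => //= [f _|f IHf g IHg|f _ g IHg]; first by rewrite negbK.
  by rewrite IHf IHg negb_or.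
by rewrite IHg negb_imply.
Qed.

Lemma mkAndE f g : ev (mkAnd f g) = ev f && ev g.
Proof.
by case: f => [[]|?|?|? ?|? ?|? ?|? ?] //;
   case: g => [[]|?|?|? ?|? ?|? ?|? ?]; rewrite /= ?andbT ?andbF.
Qed.

Lemma mkOrE f g : ev (mkOr f g) = ev f || ev g.
Proof.
by case: f => [[]|?|?|? ?|? ?|? ?|? ?] //;
   case: g => [[]|?|?|? ?|? ?|? ?|? ?]; rewrite /= ?orbT ?orbF.
Qed.

Lemma mkImpE f g : ev (mkImp f g) = (ev f ==> ev g).
Proof.
have h : ev (mkNot f) = (ev f ==> false) by rewrite mkNotE; case: (ev f).
by case: f h => [[]|?|?|? ?|? ?|? ?|? ?] //;
   case: g => [[]|?|?|? ?|? ?|? ?|? ?] //= _; rewrite implybT.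
Qed.

Lemma mkIffE f g : ev (mkIff f g) = (ev f == ev g).
Proof.
have h e : ev (mkNot e) = (ev e == false) by rewrite mkNotE; case: (ev e).
have h' e : ev (mkNot e) = (false == ev e) by rewrite eq_sym.
have k e : ev e = (ev e == true) by case: (ev e).
have k' e : ev e = (true == ev e) by rewrite eq_sym.
by case: f => [[]|?|?|? ?|? ?|? ?|? ?]; rewrite /mkIff -?h' -?k' //;
   case: g => [[]|?|?|? ?|? ?|? ?|? ?]; rewrite -?h -?k.
Qed.

Lemma form_setE n f : ev (form_set n (v n) f) = ev f.
Proof.
elim: f => //= [m|f IH|f IHf g IHg|f IHf g IHg|f IHf g IHg|f IHf g IHg].
- by case: eqnP => [->|].
- by rewrite mkNotE IH.
- by rewrite mkAndE IHf IHg.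
- by rewrite mkOrE IHf IHg.
- by rewrite mkImpE IHf IHg.
- by rewrite mkIffE IHf IHg.
Qed.

Lemma form_unitE f n b : form_unit f = Some (n, b) -> ev f -> v n = b.
Proof.
elim: f => //= [m [<- <-] //|[] //= m _ [<- <-] /negbTE //|].
move=> f IHf g IHg eq_u /andP[evf evg].
by case: (form_unit f) IHf eq_u => [l IHf eq_l|_ /IHg]; [apply: IHf|apply].
Qed.

Lemma form_unsatP k f : form_unsat k f -> ~~ ev f.
Proof.
elim: k f => //= k IH f unsat; apply/negP => evf.
have {}unsat : is_true (match form_unit f, form_atom f with
    | Some (n, b), _ => form_unsat k (form_set n b f)
    | _, Some n => form_unsat k (form_set n true f) && form_unsat k (form_set n false f)
    | _, _ => false
    end).
  by case: f evf unsat => [[]|?|?|? ?|? ?|? ?|? ?].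
case: (form_unit f) unsat (@form_unitE f) => [[n b] unsat|unsat _].
  move=> /(_ n b erefl evf) vb.
  by move: unsat; rewrite -vb => /IH; rewrite form_setE evf.
case: (form_atom f) unsat => // n /andP[/IH u1 /IH u2].
by case: (v n) (form_setE n f) => eqf; rewrite eqf evf in u1 u2.
Qed.

End FormSound.

Lemma form_taut k f (e : seq bool) :
  form_unsat k (mkNot f) -> form_eval (nth false e) f.
Proof. by move/form_unsatP => /(_ (nth false e)); rewrite mkNotE negbK. Qed.

Ltac mem_list x l :=
  lazymatch l with
  | nil => constr:(false)
  | x :: _ => constr:(true)
  | _ :: ?l' => mem_list x l'
  end.

Ltac index_list x l :=
  lazymatch l with
  | x :: _ => constr:(O)
  | _ :: ?l' => let n := index_list x l' in constr:(S n)
  end.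

Ltac bool_atoms b l :=
  lazymatch b with
  | true => l
  | false => l
  | negb ?a => bool_atoms a l
  | andb ?a ?a' => let l := bool_atoms a l in bool_atoms a' l
  | orb ?a ?a' => let l := bool_atoms a l in bool_atoms a' l
  | implb ?a ?a' => let l := bool_atoms a l in bool_atoms a' l
  | @eq_op Datatypes_bool__canonical__eqtype_Equality ?a ?a' =>
      let l := bool_atoms a l in bool_atoms a' l
  | _ => lazymatch mem_list b l with true => l | false => constr:(b :: l) end
  end.

Ltac bool_reify b l :=
  lazymatch b with
  | true => constr:(Cst true)
  | false => constr:(Cst false)
  | negb ?a => let f := bool_reify a l in constr:(Not f)
  | andb ?a ?a' => let f := bool_reify a l in let g := bool_reify a' l in constr:(And f g)
  | orb ?a ?a' => let f := bool_reify a l in let g := bool_reify a' l in constr:(Or f g)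
  | implb ?a ?a' => let f := bool_reify a l in let g := bool_reify a' l in constr:(Imp f g)
  | @eq_op Datatypes_bool__canonical__eqtype_Equality ?a ?a' =>
      let f := bool_reify a l in let g := bool_reify a' l in constr:(Iff f g)
  | _ => let n := index_list b l in constr:(Atom n)
  end.

Ltac bool_taut :=
  lazymatch goal with
  | |- is_true ?b =>
    let l := bool_atoms b (@nil bool) in
    let f := bool_reify b l in
    change (is_true (form_eval (nth false l) f));
    (* Every recursive call eliminates an atom, so 1000 bounds the number of atoms set along one
       branch. *)
    apply: (@form_taut 1000); vm_compute; reflexivity
  end.

(* Reduces a goal about finite sets to a propositional one about the membership
   of a generic point [t], instantiating every set hypothesis at [t]. *)
Ltac set_tac :=
  let t := fresh "t" in
  pw_goal => t;
  repeat match goal with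
  | H : is_true (subset _ _) |- _ => apply (@pw_sub _ t) in H
  | H : is_true (disjoint _ _) |- _ => apply (@pw_dis _ t) in H
  | H : @eq {set _} _ _ |- _ => apply (@pw_eq _ t) in H
  | H : is_true (~~ (_ == _)) |- _ => apply (@pw_neq _ t) in H
  | H : is_true (~~ (in_mem _ _)) |- _ => apply (@pw_notin _ t) in H
  | H : is_true (in_mem _ _) |- _ => apply (@pw_in _ t) in H
  end;
  repeat match goal with
  | H : is_true (implb _ _) |- _ => refine (imp_elim H _); clear H
  | H : is_true (@eq_op Datatypes_bool__canonical__eqtype_Equality _ _) |- _ =>
      refine (imp_elim H _); clear H
  end;
  rewrite ?inE ?eqxx; bool_taut.

(* Arithmetic from the numerical hypotheses only: lia is slow on the others. *)
Ltac nlia :=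
  repeat match goal with
  | H : ?P |- _ =>
    lazymatch type of P with
    | Prop => lazymatch P with
      | is_true (leq _ _) => fail
      | is_true (andb (leq _ _) (leq _ _)) => fail
      | @eq nat _ _ => fail
      | _ => clear H
      end
    end
  end; lia.

(** * Cardinalities, subsets of prescribed size and exchanges *)

Section Cards.
Variable T : finType.
Implicit Types A B C E F K : {set T}.

Lemma card1U x A : x \notin A -> #|x |: A| = #|A|.+1.
Proof. by move=> xA; rewrite cardsU1 xA. Qed.

Lemma cardU_disjoint A B : [disjoint A & B] -> #|A :|: B| = #|A| + #|B|.
Proof. by move=> dAB; apply/eqP; have [_ ->] := leq_card_setU A B. Qed.

Lemma cardD_sub A B : B \subset A -> #|A :\: B| + #|B| = #|A|.
Proof. by move=> BA; rewrite cardsDS // subnK ?subset_leq_card. Qed.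

Lemma ex_subset_between A B m : A \subset B -> #|A| <= m <= #|B| ->
  exists C : {set T}, [/\ A \subset C, C \subset B & #|C| = m].
Proof.
elim: m => [|m IH] AB /andP[Am mB].
  by move: Am; rewrite leqn0 => /eqP Am; exists A.
move: Am; rewrite leq_eqVlt => /orP[/eqP Am|]; first by exists A.
rewrite ltnS => Am; have [|C [AC CB Cm]] := IH AB; first by rewrite Am ltnW.
have /subsetPn[x xB xC] : ~~ (B \subset C).
  by apply: contraL mB => /subset_leq_card; rewrite Cm -leqNgt.
exists (x |: C); split; [set_tac|set_tac|by rewrite card1U ?Cm].
Qed.

Lemma ex_subset B m : m <= #|B| -> exists2 C : {set T}, C \subset B & #|C| = m.
Proof.
move=> mB; have [||C [_ CB Cm]] := @ex_subset_between set0 B m.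
- exact: sub0set.
- by rewrite cards0.
- by exists C.
Qed.

Lemma ex_mem A : 0 < #|A| -> exists x, x \in A.
Proof. by move/card_gt0P. Qed.

Lemma ex_notin A B : #|B| < #|A| -> exists2 x, x \in A & x \notin B.
Proof.
by move=> ltBA; apply/subsetPn; apply: contraL ltBA => /subset_leq_card; rewrite -leqNgt.
Qed.

Lemma ex_two A : 1 < #|A| -> exists x y, [/\ x \in A, y \in A & x != y].
Proof. by move/card_gt1P. Qed.

(* Follow a chain of single-element exchanges from E to F up to the first failure
   of P. *)
Lemma ex_exchange (P : pred {set T}) B E F :
    E \subset B -> F \subset B -> #|E| = #|F| -> P E -> ~~ P F ->
  exists (K : {set T}) (a b : T),
    [/\ [/\ a \notin K, b \notin K & a != b], a |: K \subset B,
        b |: K \subset B, #|K|.+1 = #|E| & P (a |: K) && ~~ P (b |: K)].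
Proof.
move=> EB FB; have [m] := ubnP #|E :\: F|.
elim: m E EB => // m IH E EB ltm EF PE PF.
have EFne : #|E :&: F| < #|E|.
  rewrite ltnNge; apply: contra PF => le_E.
  suff <- : E = F by [].
  have /eqP EI : E :&: F == E by rewrite eqEcard subsetIl.
  by apply/eqP; rewrite eqEcard EF leqnn andbT -EI subsetIr.
have [a aE aF] : exists2 a, a \in E & a \notin F.
  by have [a aE] := ex_notin EFne; rewrite inE aE /= => aF; exists a.
have [b bF bE] : exists2 b, b \in F & b \notin E.
  have : #|E :&: F| < #|F| by rewrite -EF.
  by case/ex_notin => b bF; rewrite inE bF andbT => bE; exists b.
have aK : a |: E :\ a = E by rewrite setD1K.
have cardK : #|E :\ a|.+1 = #|E| by rewrite -(card1U (x := a)) ?aK // !inE eqxx.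
have bK : b \notin E :\ a by set_tac.
have bKB : b |: E :\ a \subset B by set_tac.
have [Pb|nPb] := boolP (P (b |: E :\ a)); last first.
  exists (E :\ a), a, b; split; rewrite ?aK ?PE //; split=> //; first by set_tac.
  by set_tac.
have [||K [a' [b' [h1 h2 h3 h4 h5]]]] := IH _ bKB _ _ Pb PF.
- have : (b |: E :\ a) :\: F \subset (E :\: F) :\ a by set_tac.
  move/subset_leq_card => leq1; rewrite (cardsD1 a) inE aE aF in ltm.
  by apply: leq_ltn_trans leq1 _; rewrite -ltnS.
- by rewrite card1U // cardK.
by exists K, a', b'; split; rewrite // h4 card1U.
Qed.

End Cards.

(** * Loose paths and cycles as vertex sets *)

Section LoosePaths.
Variables (T : finType) (s : nat) (c : {set T} -> bool).
Implicit Types (b : bool) (n : nat) (x y z : T) (A B E S U V W X Y : {set T}).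

Definition edge b E := (#|E| == s.+1) && (c E == b).

(** The condition on [E :&: W] concerns the union [W] of all later edges; with [x != z] at every
    stage it makes consecutive edges share one vertex and all other pairs disjoint. Only the ends
    and the vertex set are remembered. *)
Fixpoint lpath b n x y U : Prop :=
  if n is n'.+1 then
    exists z E W, [/\ edge b E, x \in E, x != z, lpath b n' z y W &
      E :&: W = [set z] /\ U = E :|: W]
  else x = y /\ U = [set x].

Definition lcycle b n U : Prop :=
  exists x y W E, [/\ lpath b n.-1 x y W, x != y, edge b E,
    E :&: W = [set x; y] & U = W :|: E].

Definition has_lpath b n V := exists x y U, lpath b n x y U /\ U \subset V.

Definition has_lcycle b n V := exists2 U, lcycle b n U & U \subset V.

Lemma has_lcycleS b n V W : V \subset W -> has_lcycle b n V -> has_lcycle b n W.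
Proof. by move=> VW [U cU UV]; exists U => //; apply: subset_trans VW. Qed.

Lemma has_lpathS b n V W : V \subset W -> has_lpath b n V -> has_lpath b n W.
Proof.
by move=> VW [x [y [U [pU UV]]]]; exists x, y, U; split=> //; apply: subset_trans VW.
Qed.

Lemma edge_intro b E : #|E| = s.+1 -> c E = b -> edge b E.
Proof. by rewrite /edge => -> ->; rewrite !eqxx. Qed.

Lemma edge_card b E : edge b E -> #|E| = s.+1.
Proof. by case/andP => /eqP. Qed.

Lemma edgeN b E : #|E| = s.+1 -> ~~ edge b E -> edge (~~ b) E.
Proof. by rewrite /edge => ->; rewrite eqxx /=; case: (c E); case: b. Qed.

Lemma edge_excl b E : edge b E -> ~~ edge (~~ b) E.
Proof. by rewrite /edge => /andP[-> /eqP ->]; case: b. Qed.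

Lemma lpath_start b n x y U : lpath b n x y U -> x \in U.
Proof.
case: n => [|n] /=; first by case=> _ ->; rewrite set11.
by case=> z [E [W [_ xE _ _ [_ ->]]]]; rewrite inE xE.
Qed.

Lemma lpath_end b n x y U : lpath b n x y U -> y \in U.
Proof.
elim: n x U => [|n IH] x U /=; first by case=> <- ->; rewrite set11.
by case=> z [E [W [_ _ _ /IH yW [_ ->]]]]; rewrite inE yW orbT.
Qed.

Lemma lpath_card b n x y U : lpath b n x y U -> #|U| = (s * n).+1.
Proof.
elim: n x U => [|n IH] x U /=; first by case=> _ ->; rewrite cards1 muln0.
case=> z [E [W [/edge_card cE _ _ /IH cW [EW ->]]]].
by rewrite cardsU EW cards1 cE cW; lia.
Qed.

Lemma lpath_neq b n x y U : lpath b n.+1 x y U -> x != y.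
Proof.
case=> z [E [W [_ xE xz /lpath_end yW [EW _]]]].
by apply: contra xz => /eqP xy; rewrite -in_set1 -EW inE xE xy.
Qed.

Lemma lpath1 b E x y : edge b E -> x \in E -> y \in E -> x != y ->
  lpath b 1 x y E.
Proof.
move=> eE xE yE xy; exists y, E, [set y]; split=> //; split.
  by set_tac.
by set_tac.
Qed.

Lemma lpath_rcons b n x z y U E : lpath b n x z U -> edge b E ->
  E :&: U = [set z] -> y \in E -> y != z -> lpath b n.+1 x y (U :|: E).
Proof.
elim: n x U => [|n IH] x U.
  case=> <- -> eE Ex yE yx; rewrite setUC (setUidPl _).
    apply: lpath1 => //; last by rewrite eq_sym.
    by set_tac.
  by set_tac.
case=> v [F [W [eF xF xv pW [FW UE]]]] eE EU yE yz.
have zW := lpath_end pW.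
exists v, F, (W :|: E); split=> //.
  apply: IH => //.
  by set_tac.
split; last by rewrite UE setUA.
have vW := lpath_start pW.
by set_tac.
Qed.

Lemma lpath_rev b n x y U : lpath b n x y U -> lpath b n y x U.
Proof.
elim: n x U => [|n IH] x U; first by case=> <- ->.
case=> z [E [W [eE xE xz /IH pW [EW ->]]]].
by rewrite setUC; apply: lpath_rcons pW eE EW xE xz.
Qed.

(** In the first edge only the joint [z] is tied to the rest, so each of the other s vertices can
    serve as the start. This freedom is later used to steer ends away from bad vertices. *)
Lemma lpath_starts b n x y U : lpath b n.+1 x y U ->
  exists A z, [/\ [/\ x \in A, A \subset U & #|A| = s],
    lpath b n z y (U :\: A) & forall a, a \in A -> lpath b n.+1 a y U].
Proof.
case=> z [E [W [eE xE xz pW [EW UE]]]].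
have zW := lpath_start pW; have zE : z \in E by set_tac.
exists (E :\ z), z; split.
- split; [by set_tac|by set_tac|].
  have := edge_card eE; rewrite (cardsD1 z) zE; lia.
- by rewrite (_ : _ :\: _ = W) //; set_tac.
- by move=> a aE; exists z, E, W; split=> //; set_tac.
Qed.

(** With at least two edges the first and the last differ, so both ends can be chosen freely and
    independently. *)
Lemma lpath_ends b n x y U : lpath b n.+2 x y U ->
  exists A B z w,
    [/\ [/\ x \in A, A \subset U, #|A| = s & lpath b n.+1 z y (U :\: A)],
        [/\ y \in B, B \subset U, #|B| = s & lpath b n.+1 x w (U :\: B)],
        [disjoint A & B] &
        forall a d, a \in A -> d \in B -> lpath b n.+2 a d U].
Proof.
case=> z [E [W [eE xE xz pW [EW UE]]]].
have {}pW : lpath b n.+1 z y W := pW.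
have zW := lpath_start pW; have zE : z \in E by set_tac.
have [B [w [[yB BW cB] /lpath_rev pB allB]]] := lpath_starts (lpath_rev pW).
have zB : z \notin B by have := lpath_start pB; rewrite inE => /andP[].
exists (E :\ z), B, z, w; split.
- split; [by set_tac|by set_tac| |].
    have := edge_card eE; rewrite (cardsD1 z) zE; lia.
  by rewrite (_ : _ :\: _ = W) //; set_tac.
- split; [by []|by set_tac|by []|].
  by exists z, E, (W :\: B); split=> //; split; set_tac.
- by set_tac.
move=> a d aE dB; exists z, E, W; split=> //; [by set_tac|by set_tac|].
exact: lpath_rev (allB d dB).
Qed.

End LoosePaths.

Ltac same_edge H :=
  lazymatch goal with |- is_true (edge _ _ _ ?E) =>
    lazymatch type of H with is_true (edge _ _ _ ?F) =>
      rewrite (_ : E = F); [exact: H | set_tac]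
    end
  end.

(** * Closing and extending loose paths *)

Section LooseCycles.
Variables (T : finType) (s : nat) (c : {set T} -> bool).
Hypothesis s_gt1 : 1 < s.
Implicit Types (b : bool) (n : nat) (x y z : T) (A B E F Q S U V W X Y Z : {set T}).
Local Notation edge := (edge s c).
Local Notation lpath := (lpath s c).
Local Notation has_lpath := (has_lpath s c).
Local Notation has_lcycle := (has_lcycle s c).

Lemma lcycle_close b n x y U E V : lpath b n x y U -> x != y -> edge b E ->
  E :&: U = [set x; y] -> U \subset V -> E \subset V -> has_lcycle b n.+1 V.
Proof.
move=> pU xy eE EU UV EV; exists (U :|: E); last by set_tac.
by exists x, y, U, E.
Qed.

Lemma triangle_intro b F p q m X Y V : edge b F -> p \in F -> q \in F -> p != q ->
    [disjoint F & X] -> [disjoint F & Y] -> X :&: Y = [set m] ->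
    edge b (p |: X) -> edge b (q |: Y) ->
    F \subset V -> X \subset V -> Y \subset V ->
  has_lcycle b 3 V.
Proof.
move=> eF pF qF pq FX FY XY eX eY FV XV YV.
apply: (@lcycle_close b 2 p q ((p |: X) :|: (q |: Y)) F) => //.
- exists m, (p |: X), (q |: Y); split=> //; [by set_tac|by set_tac| |].
    by apply: lpath1 => //; set_tac.
  by split=> //; set_tac.
- by set_tac.
- by set_tac.
Qed.

(** The path is closed by the detour y1, q, r, y2 with [F] as its middle edge, which adds three
    edges. *)
Lemma lcycle_close3 b n q r y1 y2 A1 A2 F U V :
    edge b F -> q \in F -> r \in F -> q != r ->
    lpath b n y1 y2 U -> y1 != y2 ->
    edge b (q |: (y1 |: A1)) -> edge b (r |: (y2 |: A2)) ->
    [disjoint F & U] -> [disjoint F & A1] -> [disjoint F & A2] ->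
    [disjoint A1 & A2] -> [disjoint A1 & U] -> [disjoint A2 & U] ->
    F \subset V -> U \subset V -> A1 \subset V -> A2 \subset V ->
  has_lcycle b n.+3 V.
Proof.
move=> eF qF rF qr pU y12 e1 e2 FU FA1 FA2 A12 A1U A2U FV UV A1V A2V.
have y1U := lpath_start pU; have y2U := lpath_end pU.
have p1 : lpath b n.+1 q y2 ((q |: (y1 |: A1)) :|: U).
  exists y1, (q |: (y1 |: A1)), U; split=> //; [by set_tac|by set_tac|].
  by split=> //; set_tac.
have p2 : lpath b n.+2 q r (((q |: (y1 |: A1)) :|: U) :|: (r |: (y2 |: A2))).
  by apply: lpath_rcons p1 e2 _ _ _; set_tac.
by apply: lcycle_close p2 qr eF _ _ _; set_tac.
Qed.

(** Greedy construction: after each edge all its vertices but the next joint are discarded, at a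
    cost of s vertices. *)
Lemma lpath_complete b n x V : (forall E, E \subset V -> #|E| = s.+1 -> edge b E) ->
  x \in V -> s * n < #|V| -> exists y U, lpath b n x y U /\ U \subset V.
Proof.
elim: n x V => [|n IH] x V eV xV ltV.
  by exists x, [set x]; split=> //; set_tac.
have [||E [xE EV cE]] := @ex_subset_between _ [set x] V s.+1.
- by set_tac.
- by rewrite cards1; nlia.
have {}xE : x \in E by set_tac.
have [z] : exists z, z \in E :\ x.
  by apply: ex_mem; move: cE; rewrite (cardsD1 x) xE; nlia.
rewrite !inE => /andP[zx zE].
have [|||y [U [pU UV]]] := IH z (V :\: (E :\ z)).
- by move=> F FV; apply: eV; set_tac.
- by set_tac.
- have : E :\ z \subset V by set_tac.
  by move/cardD_sub; move: cE; rewrite (cardsD1 z E) zE; nlia.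
have zU := lpath_start pU.
exists y, (E :|: U); split; last by set_tac.
exists z, E, U; split=> //; [by apply: eV| by rewrite eq_sym|].
by split=> //; set_tac.
Qed.

Lemma lcycle_complete b n V : (forall E, E \subset V -> #|E| = s.+1 -> edge b E) ->
  s * n.+2 <= #|V| -> has_lcycle b n.+2 V.
Proof.
move=> eV leV; have [x xV] : exists x, x \in V by apply: ex_mem; nlia.
have [|y [U [pU UV]]] := @lpath_complete b n.+1 x V eV xV; first by nlia.
have cU := lpath_card pU; have cVU := cardD_sub UV.
have [|S SV cS] := @ex_subset _ (V :\: U) s.-1; first by nlia.
have xU := lpath_start pU; have yU := lpath_end pU; have xy := lpath_neq pU.
apply: (@lcycle_close b n.+1 x y U (x |: (y |: S))) => //; [|by set_tac|by set_tac].
apply: eV; first by set_tac.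
by rewrite !card1U ?cS; [nlia|by set_tac|by set_tac].
Qed.

(** This forces colours: if [V] has no path with n+2 edges, any continuation [r |: Q] must have the
    other colour. *)
Lemma lpath_extend b n p q r Z E Q V :
    lpath b n p q Z -> edge b E -> E :&: Z = [set q] -> r \in E -> r != q ->
    [disjoint Q & Z] -> [disjoint Q & E] -> #|Q| = s ->
    Z \subset V -> E \subset V -> Q \subset V ->
  has_lpath b n.+2 V \/ edge (~~ b) (r |: Q).
Proof.
move=> pZ eE EZ rE rq QZ QE cQ ZV EV QV; have qZ := lpath_end pZ.
have p2 : lpath b n.+1 p r (Z :|: E) by apply: lpath_rcons pZ eE _ rE rq.
have cr : #|r |: Q| = s.+1 by rewrite card1U ?cQ //; set_tac.
have [er|/(edgeN cr) ?] := boolP (edge b (r |: Q)); last by right.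
left; have [d dQ] : exists d, d \in Q by apply: ex_mem; nlia.
exists p, d, (Z :|: E :|: (r |: Q)); split; last by set_tac.
by apply: lpath_rcons p2 er _ _ _; set_tac.
Qed.

(* If the red path does not exist, every edge that leaves the cycle at a joint and
   uses one of two further vertices u, v is blue, and three of these form a blue
   triangle. *)
Lemma lcycle_lpath n V : 3 <= n -> s * n + 2 <= #|V| ->
  has_lcycle true n V -> has_lpath true n V \/ has_lcycle false 3 V.
Proof.
case: n => [|[|[|n]]] // _ leV [U [x [y [W [E [pW xy eE EW UE]]]]] UV].
have xW := lpath_start pW; have yW := lpath_end pW.
have cW := lpath_card pW; have cE := edge_card eE.
have cU : #|U| = s * n.+3.
  have := cardsUI W E; rewrite -UE setIC EW cards2 xy cW cE; nlia.
have [u [v [uVU vVU uv]]] : exists u v, [/\ u \in V :\: U, v \in V :\: U & u != v].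
  by apply: ex_two; have := cardD_sub UV; nlia.
have [A [B [z [w [[xA AW cA pA] [yB BW cB pB] AB _]]]]] := lpath_ends pW.
pose I := E :\: W.
have cI : #|I|.+1 = s.
  by have := cardsID W E; rewrite EW cards2 xy cE /I; nlia.
have [i iI] : exists i, i \in I by apply: ex_mem; nlia.
have WV : W \subset V by set_tac.
have EV : E \subset V by set_tac.
(* The size s-2 leaves room for [y], [u] and [v] in one edge. *)
have [|B' B'B cB'] := @ex_subset _ (B :\ y) s.-2.
  by move: cB; rewrite (cardsD1 y) yB; nlia.
have cAx : #|A :\ x|.+1 = s by move: cA; rewrite (cardsD1 x) xA.
have cuvB' : #|u |: (v |: B')| = s.
  by rewrite !card1U ?cB'; [nlia|set_tac|set_tac].
have cuA : #|u |: (A :\ x)| = s by rewrite card1U //; set_tac.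
have cvI : #|v |: I| = s by rewrite card1U // /I; set_tac.
(* The path without [A], followed by [E] back to [x], is one edge short of the required length, and
   [A :\ x] is free again for the last edge. *)
have [|blue1] : has_lpath true n.+3 V \/ edge false (x |: (u |: (A :\ x))).
- by apply: lpath_extend pA eE _ _ _ _ _ cuA _ _ _; set_tac.
- by left.
have [|blue2] : has_lpath true n.+3 V \/ edge false (y |: (u |: (v |: B'))).
- by apply: lpath_extend (lpath_rev pB) eE _ _ _ _ _ cuvB' _ _ _; set_tac.
- by left.

have [red3|blue3] := boolP (edge true (x |: (v |: I))).
  left; exists y, i, (W :|: (x |: (v |: I))); split; last by rewrite /I; set_tac.
  by apply: lpath_rcons (lpath_rev pW) red3 _ _ _; rewrite /I in iI *; set_tac.
have {}blue3 : edge false (x |: (v |: I)).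
  by apply: (@edgeN _ s c true) => //; rewrite card1U ?cvI // /I; set_tac.
(* The three blue edges meet pairwise exactly in [u], [v] and [x]. *)
right; apply: (@triangle_intro false (y |: (u |: (v |: B'))) u v x A (x |: I)) => //;
  rewrite /I; try set_tac; [same_edge blue1|same_edge blue3].
Qed.

End LooseCycles.

(** * A red and a blue edge sharing s vertices *)

(* O consists of the vertices of V outside a |: (d |: K), so a red loose cycle of
   length n through a |: K has to cover all but one vertex of d |: O. *)
Section Switch.
Variables (T : finType) (s : nat) (c : {set T} -> bool).
Hypothesis s_gt1 : 1 < s.
Local Notation edge := (edge s c).
Local Notation lpath := (lpath s c).
Local Notation has_lpath := (has_lpath s c).
Local Notation has_lcycle := (has_lcycle s c).

Implicit Types (x y z q r m p k : T) (A B E F S U W X Y Z : {set T}).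
Variables (V K O : {set T}) (a d : T) (n : nat).
Hypotheses (aK : a \notin K) (dK : d \notin K) (ad : a != d).
Hypotheses (aO : a \notin O) (dO : d \notin O) (OK : [disjoint O & K]).
Hypotheses (aV : a \in V) (dV : d \in V) (KV : K \subset V) (OV : O \subset V).
Hypotheses (cK : #|K| = s) (cO : #|O| + s + 1 = s * n).
Hypotheses (red_aK : edge true (a |: K)) (blue_dK : edge false (d |: K)).
Hypotheses (no_red : ~ has_lcycle true n V) (no_blue : ~ has_lcycle false 3 V).

Lemma edge_red E : #|E| = s.+1 -> (edge false E -> False) -> edge true E.
Proof.
move=> cE nE; apply/negPn/negP => /(edgeN cE) /nE.
exact.
Qed.

Lemma edge_blue E : #|E| = s.+1 -> (edge true E -> False) -> edge false E.
Proof.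
move=> cE nE; apply/negPn/negP => /(edgeN cE) /nE.
exact.
Qed.

Lemma switch_close3 (m : nat) (y1 y2 : T) W q r (A1 A2 : {set T}) :
    m.+3 = n -> lpath true m y1 y2 W -> y1 != y2 -> W \subset d |: O ->
    q \in K -> r \in K -> q != r -> A1 \subset O -> A2 \subset O ->
    [disjoint A1 & A2] -> [disjoint A1 & W] -> [disjoint A2 & W] ->
    edge true (q |: (y1 |: A1)) -> edge true (r |: (y2 |: A2)) -> False.
Proof.
move=> mn pW y12 WO qK rK qr A1O A2O A12 A1W A2W e1 e2; apply: no_red.
rewrite -mn; apply: (lcycle_close3 red_aK _ _ qr pW y12 e1 e2); clear no_red; set_tac.
Qed.

Lemma switch_triangle q r m (Y1 Y2 : {set T}) : n = 3 -> q \in K -> r \in K -> q != r ->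
  Y1 \subset O -> Y2 \subset O -> Y1 :&: Y2 = [set m] ->
  edge true (q |: Y1) -> edge true (r |: Y2) -> False.
Proof.
move=> n3 qK rK qr Y1O Y2O Y12 e1 e2; apply: no_red; rewrite n3.
by apply: (triangle_intro red_aK _ _ qr _ _ Y12 e1 e2); set_tac.
Qed.

Lemma switch_blue q r m (Y1 Y2 : {set T}) : q \in K -> r \in d |: K -> q != r ->
  Y1 \subset O -> Y2 \subset O -> #|Y2| = s -> Y1 :&: Y2 = [set m] ->
  edge false (q |: Y1) -> edge true (r |: Y2).
Proof.
move=> qK rK qr Y1O Y2O cY2 Y12 e1; apply: edge_red => [|e2].
  by rewrite card1U ?cY2 //; set_tac.
apply: no_blue.
by apply: (triangle_intro blue_dK _ _ qr _ _ Y12 e1 e2); set_tac.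
Qed.

Lemma ex_meeting_pair (S : {set T}) : 2 * s - 1 <= #|S| -> exists (X Y : {set T}) m,
  [/\ [/\ X \subset S & Y \subset S], #|X| = s, #|Y| = s & X :&: Y = [set m]].
Proof.
move=> leS; have [|X XS cX] := @ex_subset _ S s; first by nlia.
have [m mX] : exists m, m \in X by apply: ex_mem; nlia.
have cSX := cardD_sub XS.
have [|Y YS cY] := @ex_subset _ (S :\: X) s.-1; first by nlia.
exists X, (m |: Y), m; split=> //; [by split; set_tac| |by set_tac].
by rewrite card1U; [nlia|set_tac].
Qed.

(** * The case where all edges from K into O are red *)

Section AllRed.
Hypothesis all_red : forall k Y, k \in K -> Y \subset O -> #|Y| = s -> edge true (k |: Y).

(** Two disjoint (s-1)-sets of [O :\: W] complete the edges from [q] to [y1] and from [r] to [y2].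
    The ends avoid [d] because only edges with all but one vertex in [O] are known to be red. *)
Lemma all_red_path (m : nat) (y1 y2 : T) W : m.+3 = n -> lpath true m y1 y2 W -> y1 != y2 ->
  W \subset d |: O -> y1 != d -> y2 != d -> 2 * s <= #|O :\: W| + 2 -> False.
Proof.
move=> mn pW y12 WO y1d y2d leOW.
have [q [r [qK rK qr]]] : exists q r, [/\ q \in K, r \in K & q != r].
  by apply: ex_two; rewrite cK.
have [|A1 A1O cA1] := @ex_subset _ (O :\: W) s.-1; first by nlia.
have cOW := cardD_sub A1O.
have [|A2 A2O cA2] := @ex_subset _ (O :\: W :\: A1) s.-1; first by nlia.
have y1W := lpath_start pW; have y2W := lpath_end pW.
apply: (switch_close3 mn pW y12 WO qK rK qr (A1 := A1) (A2 := A2)); try set_tac.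
  by apply: all_red => //; [set_tac|rewrite card1U; [nlia|set_tac]].
by apply: all_red => //; [set_tac|rewrite card1U; [nlia|set_tac]].
Qed.

Lemma all_red_false : 3 <= n ->
  (5 <= n -> has_lcycle true n.-2 (d |: O)) -> False.
Proof.
move=> n3 IH; have cdO : #|d |: O| = #|O|.+1 by rewrite card1U.
have [n_eq3|n_neq3] := eqVneq n 3.
  have [|X [Y [m [[XO YO] cX cY XY]]]] := @ex_meeting_pair O; first by subst; nlia.
  have [q [r [qK rK qr]]] : exists q r, [/\ q \in K, r \in K & q != r].
    by apply: ex_two; rewrite cK.
  by apply: (switch_triangle n_eq3 qK rK qr XO YO XY); apply: all_red.
have [n_eq4|n_neq4] := eqVneq n 4.
  have cO' : #|O| = 3 * s - 1 by move: cO; rewrite n_eq4; nlia.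
  (* For n = 4 a single red edge serves as the path. If neither an edge inside [O] nor [d |: S] is
     red, then [d |: S] and two edges inside [O] form a blue triangle. *)
  have [/existsP[g /andP[gO red_g]]|] := boolP [exists g : {set T}, (g \subset O) && edge true g].
    have [x [y [xg yg xy]]] : exists x y, [/\ x \in g, y \in g & x != y].
      by apply: ex_two; rewrite (edge_card red_g); nlia.
    apply: (@all_red_path 1 x y g); [by []|exact: lpath1|by []|..]; try set_tac.
    by have := cardD_sub gO; have := edge_card red_g; nlia.
  rewrite negb_exists => /forallP no_g.
  have blue_O E : E \subset O -> #|E| = s.+1 -> edge false E.
    by move=> EO cE; apply: edge_blue => // eE; have := no_g E; rewrite EO eE.
  have [|S SO cS] := @ex_subset _ O s; first by nlia.
  have cOS := cardD_sub SO.
  have [x [y [xS yS xy]]] : exists x y, [/\ x \in S, y \in S & x != y].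
    by apply: ex_two; rewrite cS.
  have cdS : #|d |: S| = s.+1 by rewrite card1U ?cS //; set_tac.
  have [red_dS|/(edgeN cdS) blue_dS] := boolP (edge true (d |: S)).
    apply: (@all_red_path 1 x y (d |: S)); [by []|apply: lpath1 => //; set_tac|by []|..]; try set_tac.
    have -> : O :\: (d |: S) = O :\: S by set_tac.
    by nlia.
  have [|X [Y [m [[XO YO] cX cY XY]]]] := @ex_meeting_pair (O :\: S); first by nlia.
  apply: no_blue; apply: (@triangle_intro _ _ c false (d |: S) x y m X Y); try set_tac.
  - by apply: blue_dS.
  - by apply: blue_O; [set_tac|rewrite card1U ?cX //; set_tac].
  - by apply: blue_O; [set_tac|rewrite card1U ?cY //; set_tac].
case En: n n3 n_neq3 n_neq4 => [|[|[|[|[|m]]]]] // _ _ _.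
(* Dropping the closing edge of the cycle of length n-2 leaves a path with n-3 edges. It has
   s(n-3)+1 vertices, so at least 2s-2 vertices of [O] stay free. *)
have [|U [x [y [W [E [pW _ _ _ UE]]]]] UO] := IH; first by rewrite En.
rewrite En in pW; have {}pW : lpath true m.+2 x y W := pW.
have [A [B [z [w [[_ AW cA _] [_ BW cB _] AB pAB]]]]] := lpath_ends pW.
have [y1 y1A y1d] : exists2 y1, y1 \in A & y1 \notin [set d].
  by apply: ex_notin; rewrite cards1 cA.
have [y2 y2B y2d] : exists2 y2, y2 \in B & y2 \notin [set d].
  by apply: ex_notin; rewrite cards1 cB.
apply: (all_red_path _ (pAB _ _ y1A y2B)); [by []|by set_tac|by set_tac|by set_tac|by set_tac|].
have cW := lpath_card pW; have := cardsID W O.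
have : #|O :&: W| <= #|W| by rewrite subset_leq_card ?subsetIr.
by move: cO; rewrite En; nlia.
Qed.

End AllRed.

(** * The case where some edge from K into O is blue *)

Section SomeBlue.
Hypothesis s_gt2 : 2 < s.
Variables (p : T) (X : {set T}).
Hypotheses (pK : p \in K) (XO : X \subset O) (cX : #|X| = s).
Hypothesis blue_pX : edge false (p |: X).

Lemma ex_two_K p' : p' \in K -> exists q r, [/\ q \in K :\ p', r \in K :\ p' & q != r].
Proof. by move=> p'K; apply: ex_two; move: cK; rewrite (cardsD1 p') p'K; nlia. Qed.

(* Blue at Y forces red at the set Z of the other vertices of O together with x,
   and with the red a |: K this forces blue at the exchanged set. *)
Lemma blue_exchange Y x y k : n = 3 -> Y \subset O -> #|Y| = s ->
    (exists2 k', k' \in K & edge false (k' |: Y)) ->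
    x \in Y -> y \in O -> y \notin Y -> k \in K -> edge false (k |: (y |: Y :\ x)).
Proof.
move=> n3 YO cY [k' k'K blue_k'] xY yO yY kK.
have [q [qK qk qk']] : exists q, [/\ q \in K, q != k & q != k'].
  have [|q qK] := @ex_notin _ K [set k; k'].
    by rewrite cK; apply: leq_ltn_trans s_gt2; rewrite cards2; case: eqP.
  by rewrite !inE negb_or => /andP[]; exists q.
have cYx : #|Y :\ x|.+1 = s by move: cY; rewrite (cardsD1 x) xY.
pose Z := O :\: (Y :\ x).
have cZ : #|Z| = s.
  have : Y :\ x \subset O by set_tac.
  by move/cardD_sub; rewrite -/Z; move: cO; rewrite n3; nlia.
have red_qZ : edge true (q |: Z).
  have YZ : Y :&: Z = [set x] by rewrite /Z; set_tac.
  by apply: (switch_blue k'K _ _ YO _ cZ YZ blue_k'); rewrite /Z; set_tac.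
apply: edge_blue => [|red_k].
  by rewrite !card1U ?cYx; [|set_tac|set_tac].
have ZY : Z :&: (y |: Y :\ x) = [set y] by rewrite /Z; set_tac.
by apply: (switch_triangle n3 qK kK qk _ _ ZY red_qZ red_k); rewrite /Z; set_tac.
Qed.

(** Exchanges spread blueness from [X] to all s-subsets of [O]. For [Y] and [Z] meeting in one
    vertex, [switch_blue] makes some [q |: Z] red, while one further exchange makes it blue. *)
Lemma some_blue_false3 : n = 3 -> False.
Proof.
move=> n3; pose P Z := [exists k, (k \in K) && edge false (k |: Z)].
have all_blue Z : Z \subset O -> #|Z| = s -> P Z.
  move=> ZO cZ; case: (boolP (P Z)) => // nPZ; exfalso.
  have PX : P X by apply/existsP; exists p; rewrite pK.
  (* At the first exchange that loses blueness, [blue_exchange] gives a contradiction. *)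
  have [|Y [x [y [[xY yY xy] xYO yYO cY /andP[Px nPy]]]]] := ex_exchange XO ZO _ PX nPZ.
    by rewrite cX cZ.
  case/negP: nPy; apply/existsP; exists p; rewrite pK /=.
  have := @blue_exchange (x |: Y) x y p n3 xYO.
  rewrite setU1K //; apply => //; try set_tac.
    by rewrite card1U // cY.
  by case/existsP: Px => k /andP[]; exists k.
have [|Y [Z [m [[YO ZO] cY cZ YZ]]]] := @ex_meeting_pair O.
  by move: cO; rewrite n3; nlia.
have /existsP[k /andP[kK blue_k]] := all_blue _ YO cY.
have [q [_ [qKk _ _]]] := ex_two_K kK.
have red_q : edge true (q |: Z) by apply: (switch_blue kK _ _ YO ZO cZ YZ blue_k); set_tac.
have qK : q \in K by set_tac.
have mZ : m \in Z by set_tac.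
have [|y yY ym] := @ex_notin _ Y [set m]; first by rewrite cards1 cY.
(* [W] is one exchange away from [Z]: trading [y] for [m] recovers [Z]. *)
pose W := y |: Z :\ m.
have WO : W \subset O by rewrite /W; set_tac.
have cW : #|W| = s.
  by rewrite card1U; [move: cZ; rewrite (cardsD1 m) mZ|set_tac].
have /existsP[k' /andP[k'K blue_k']] := all_blue _ WO cW.
have blue_q : edge false (q |: (m |: W :\ y)).
  apply: blue_exchange => //; [by exists k'|rewrite /W; set_tac|by set_tac|].
  by rewrite /W; set_tac.
have WZ : m |: W :\ y = Z by rewrite /W; set_tac.
by have := edge_excl red_q; rewrite -WZ blue_q.
Qed.

(** Reserve disjoint (s-1)-sets [A1] and [A2], each meeting [X] in one vertex. The rest of [d |: O]
    has exactly the size for a red path with m edges. If its ends avoid [X], the connecting edges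
    meet [X] in one vertex and are red by [switch_blue]. *)
Lemma some_blue_false6 (m : nat) : n = m.+3 -> 3 <= m ->
  (forall U, U \subset V -> s * m + 2 <= #|U| -> has_lpath true m U) -> False.
Proof.
move=> En m3 Hpath; have cO' : #|O| = s * m + 2 * s - 1.
  by move: cO; rewrite En; nlia.
have sm : s * 3 <= s * m by rewrite leq_mul2l m3 orbT.
have [q [r [qK rK qr]]] := ex_two_K pK.
have [x1 [x2 [x1X x2X x12]]] : exists x y, [/\ x \in X, y \in X & x != y].
  by apply: ex_two; rewrite cX; nlia.
have cOX := cardD_sub XO.
have [|B1 B1O cB1] := @ex_subset _ (O :\: X) s.-2; first by nlia.
have cOXB := cardD_sub B1O.
have [|B2 B2O cB2] := @ex_subset _ (O :\: X :\: B1) s.-2; first by nlia.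
pose A1 := x1 |: B1; pose A2 := x2 |: B2.
have cA1 : #|A1| = s.-1 by rewrite card1U ?cB1; [nlia|set_tac].
have cA2 : #|A2| = s.-1 by rewrite card1U ?cB2; [nlia|set_tac].
have A1O : A1 \subset O by rewrite /A1; set_tac.
have A2O : A2 \subset O by rewrite /A2; set_tac.
have A12 : [disjoint A1 & A2] by rewrite /A1 /A2; set_tac.
have A1X : A1 :&: X = [set x1] by rewrite /A1; set_tac.
have A2X : A2 :&: X = [set x2] by rewrite /A2; set_tac.
pose U := (d |: O) :\: (A1 :|: A2).
have cU : #|U| = s * m + 2.
  have A12O : A1 :|: A2 \subset d |: O by set_tac.
  have := cardD_sub A12O; rewrite -/U card1U // cardU_disjoint // cA1 cA2; nlia.
have [||y [z [W [pW WU]]]] := Hpath U; [by rewrite /U; set_tac|by rewrite cU|].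
(* These s-1 vertices must not be ends of the path; s choices at either end suffice to avoid
   them. *)
have cXd : #|d |: (X :\ x1 :\ x2)| = s.-1.
  rewrite card1U; last by set_tac.
  move: cX; rewrite (cardsD1 x1) x1X (cardsD1 x2) !inE eq_sym x12 x2X; nlia.
case: m En m3 cO' sm cU Hpath pW => [|[|m]] // En _ _ _ _ _ pW.
have [A [B [_ [_ [[_ AW cA _] [_ BW cB _] AB pAB]]]]] := lpath_ends pW.
have [|y1 y1A y1X] := @ex_notin _ A (d |: (X :\ x1 :\ x2)); first by nlia.
have [|y2 y2B y2X] := @ex_notin _ B (d |: (X :\ x1 :\ x2)); first by nlia.
have A1W : [disjoint A1 & W] by rewrite /U in WU; set_tac.
have A2W : [disjoint A2 & W] by rewrite /U in WU; set_tac.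
have WdO : W \subset d |: O by rewrite /U in WU; set_tac.
have y1A1 : y1 \notin A1 by set_tac.
have y2A2 : y2 \notin A2 by set_tac.
have y1NX : y1 \notin X by rewrite /A1 /A2 in A1W A2W; set_tac.
have y2NX : y2 \notin X by rewrite /A1 /A2 in A1W A2W; set_tac.
apply: (switch_close3 _ (pAB _ _ y1A y2B) _ WdO _ _ qr A1O A2O A12 A1W A2W).
- by rewrite En.
- by set_tac.
- by set_tac.
- by set_tac.
- apply: (@switch_blue p q x1 X) => //; try set_tac.
  by rewrite card1U // cA1; nlia.
- apply: (@switch_blue p r x2 X) => //; try set_tac.
  by rewrite card1U // cA2; nlia.
Qed.


Lemma some_blue_red_d k Y y (D : {set T}) : k \in K -> Y \subset O -> edge false (k |: Y) ->
  y \in Y -> D \subset O :\: Y -> #|D| = s.-1 -> edge true (d |: (y |: D)).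
Proof.
move=> kK YO blue_k yY DO cD.
have YyD : Y :&: (y |: D) = [set y] by set_tac.
apply: (switch_blue kK _ _ YO _ _ YyD blue_k); try set_tac.
by rewrite card1U ?cD; [nlia|set_tac].
Qed.

(* Minimality makes q |: Y' red for smaller intersections: these edges will be the
   neighbours of a |: K on a red cycle. *)
Lemma some_blue_minimal : exists k Y,
  [/\ k \in K /\ Y \subset O, #|Y| = s, edge false (k |: Y), 1 < #|Y :&: X| &
    forall k' Y', k' \in K -> k' != p -> Y' \subset O -> #|Y'| = s ->
      0 < #|Y' :&: X| < #|Y :&: X| -> edge true (k' |: Y')].
Proof.
pose P (u : T * {set T}) := [&& u.1 \in K, u.2 \subset O, #|u.2| == s,
  edge false (u.1 |: u.2) & 1 < #|u.2 :&: X|].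
have PpX : P (p, X) by rewrite /P /= pK XO cX eqxx blue_pX setIid cX.
case: (arg_minnP (fun u => #|u.2 :&: X|) PpX) => [[k Y]] /=.
case/and5P=> /= kK YO /eqP cY blue_k Y2 minY.
exists k, Y; split=> // k' Y' k'K k'p Y'O cY' /andP[Y'0 ltY'].
have cE : #|k' |: Y'| = s.+1 by rewrite card1U ?cY' //; set_tac.
apply: edge_red => // blue_k'; have [Y'1|Y'2] := leqP #|Y' :&: X| 1.
  have /cards1P[m Em] : #|Y' :&: X| == 1 by rewrite eqn_leq Y'1.
  have XY' : X :&: Y' = [set m] by rewrite setIC.
  have : edge true (k' |: Y') by apply: (switch_blue pK _ _ XO _ cY' XY' blue_pX); set_tac.
  by move/edge_excl; rewrite blue_k'.
have := minY (k', Y'); rewrite leqNgt ltY' /P /= k'K Y'O cY' eqxx blue_k' Y'2.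
by move/(_ isT).
Qed.

(** The red path has one or two edges and runs through [d], where [some_blue_red_d] supplies red
    edges. One connecting edge meets [X] in [Y :&: X] less a vertex, the other in a single vertex,
    so both are red by the minimality of [Y :&: X]. *)
Lemma some_blue_false45 : (n == 4) || (n == 5) -> False.
Proof.
move=> n45; have [k [Y [[kK YO] cY blue_k Y2 red_small]]] := some_blue_minimal.
have [q [r [qKp rKp qr]]] := ex_two_K pK.
have [qK qp] : q \in K /\ q != p by split; set_tac.
have [rK rp] : r \in K /\ r != p by split; set_tac.
have [y [y' [yYX y'YX yy']]] := ex_two Y2.
have cYX := cardsID Y X; rewrite setIC in cYX.
have cYy : #|(Y :&: X) :\ y|.+1 = #|Y :&: X| by rewrite (cardsD1 y (Y :&: X)) yYX.
have cYy' : #|(Y :&: X) :\ y'|.+1 = #|Y :&: X| by rewrite (cardsD1 y' (Y :&: X)) y'YX.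
have cYD : #|Y :\ y|.+1 = s by rewrite -cY (cardsD1 y Y); case/setIP: yYX => ->.
have cYDD : #|Y :\ y :\ y'|.+2 = s.
  by rewrite -cYD (cardsD1 y' (Y :\ y)) !inE eq_sym yy'; case/setIP: y'YX => ->.
have cOY := cardD_sub YO.
have leO : 3 * s - 1 <= #|O| by case/orP: n45 => /eqP n45; move: cO; rewrite n45; nlia.
(* [D1] absorbs [X :\: Y], so what remains of [O] outside [Y] and [D1] misses [X]. As [Y] meets [X]
   twice, [X :\: Y] has at most s-2 elements and [D1] keeps a vertex outside [X]. *)
have [||D1 [XD1 D1O cD1]] := @ex_subset_between _ (X :\: Y) (O :\: Y) s.-1.
- by set_tac.
- by nlia.
have cOYD := cardD_sub D1O.
have red1 : edge true (d |: (y |: D1)).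
  by apply: (some_blue_red_d kK YO blue_k) => //; set_tac.
case/orP: n45 => /eqP n45.
  have [|z zD1 zX] := @ex_notin _ D1 (X :\: Y); first by nlia.
  have [|A2 A2O cA2] := @ex_subset _ (O :\: Y :\: D1) s.-1; first by nlia.
  have zy : z != y by set_tac.
  have pg : lpath true 1 z y (d |: (y |: D1)) by apply: lpath1 => //; set_tac.
  apply: (switch_close3 _ pg zy _ qK rK qr (A1 := Y :\ y) (A2 := A2)); try set_tac.
  - by rewrite n45.
  - apply: red_small => //; [by set_tac|by rewrite card1U; [nlia|set_tac]|].
    have -> : (z |: Y :\ y) :&: X = (Y :&: X) :\ y by set_tac.
    by nlia.
  - apply: red_small => //; [by set_tac|by rewrite card1U ?cA2; [nlia|set_tac]|].
    have -> : (y |: A2) :&: X = [set y] by set_tac.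
    by rewrite cards1.
have leO5 : #|O| = 4 * s - 1 by move: cO; rewrite n45; nlia.
have [|D2 D2O cD2] := @ex_subset _ (O :\: Y :\: D1) s.-1; first by nlia.
have cOYDD := cardD_sub D2O.
have [w wO] : exists w, w \in O :\: Y :\: D1 :\: D2 by apply: ex_mem; nlia.
have cw : #|(O :\: Y :\: D1 :\: D2) :\ w|.+1 = #|O :\: Y :\: D1 :\: D2|.
  by rewrite [RHS](cardsD1 w) wO.
have [|A2 A2O cA2] := @ex_subset _ ((O :\: Y :\: D1 :\: D2) :\ w) s.-1; first by nlia.
have red2 : edge true (d |: (y' |: D2)).
  by apply: (some_blue_red_d kK YO blue_k) => //; set_tac.
(* For n = 5 the path consists of two red edges joined at [d]. *)
have pg : lpath true 2 y y' ((d |: (y |: D1)) :|: (d |: (y' |: D2))).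
  apply: (@lpath_rcons _ _ _ _ _ _ d) red2 _ _ _; try set_tac.
  by apply: lpath1 => //; set_tac.
apply: (switch_close3 _ pg yy' _ qK rK qr (A1 := w |: (Y :\ y :\ y')) (A2 := A2)); try set_tac.
- by rewrite n45.
- apply: red_small => //; [by set_tac|by rewrite !card1U; [nlia|set_tac|set_tac]|].
  have -> : (y |: (w |: Y :\ y :\ y')) :&: X = (Y :&: X) :\ y' by set_tac.
  by nlia.
- apply: red_small => //; [by set_tac|by rewrite card1U ?cA2; [nlia|set_tac]|].
  have -> : (y' |: A2) :&: X = [set y'] by set_tac.
  by rewrite cards1.
Qed.

End SomeBlue.

End Switch.

(** * The upper bound for cycles *)

Section CycleRamsey.
Variables (T : finType) (s : nat) (c : {set T} -> bool).
Hypothesis s_gt1 : 1 < s.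
Implicit Types (b : bool) (n m : nat) (x y z : T) (A B E F Q S U V W X Y Z : {set T}).
Local Notation edge := (edge s c).
Local Notation lpath := (lpath s c).
Local Notation has_lpath := (has_lpath s c).
Local Notation has_lcycle := (has_lcycle s c).

Lemma lpath_close_or b n x y U z V : s = 2 -> lpath b n.+1 x y U -> z \in V :\: U ->
  U \subset V -> has_lcycle b n.+2 V \/ edge (~~ b) [set x; y; z].
Proof.
move=> s2 pU zVU UV; have xy := lpath_neq pU.
have xU := lpath_start pU; have yU := lpath_end pU.
have c3 : #|[set x; y; z]| = s.+1.
  by rewrite -setUA !card1U ?cards1 ?s2; [|set_tac|set_tac].
have [red|/(edgeN c3)] := boolP (edge b [set x; y; z]); last by right.
by left; apply: (lcycle_close pU xy red); set_tac.
Qed.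

(* If no edge joining the two ends to a spare vertex closes the cycle, three of
   these edges form a triangle of the other colour. *)
Lemma lpath_lcycle_or b n V : s = 2 -> 2 <= n -> 2 * n + 3 <= #|V| ->
  has_lpath b n V -> has_lcycle b n.+1 V \/ has_lcycle (~~ b) 3 V.
Proof.
case: n => [|[|n]] // s2 _ leV [x [y [U [pU UV]]]].
have cU := lpath_card pU; have cVU := cardD_sub UV.
have [A [B [_ [_ [[_ AU cA _] [_ BU cB _] AB pAB]]]]] := lpath_ends pU.
have [d [d' [dV d'V dd']]] : exists x y, [/\ x \in V :\: U, y \in V :\: U & x != y].
  by apply: ex_two; move: cU; rewrite s2; nlia.
have [a [a' [aA a'A aa']]] : exists x y, [/\ x \in A, y \in A & x != y].
  by apply: ex_two; rewrite cA.
have [e [e' [eB e'B ee']]] : exists x y, [/\ x \in B, y \in B & x != y].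
  by apply: ex_two; rewrite cB.
have [|bl1] := lpath_close_or s2 (pAB _ _ aA eB) dV UV; first by left.
have [|bl2] := lpath_close_or s2 (pAB _ _ aA e'B) d'V UV; first by left.
have [|bl3] := lpath_close_or s2 (pAB _ _ a'A eB) d'V UV; first by left.
right; apply: (@triangle_intro _ _ c _ [set a; e; d] a e d' [set e'; d'] [set a'; d']) => //;
  [by set_tac|by set_tac|by set_tac|by set_tac|by set_tac|by set_tac| | |by set_tac|by set_tac|by set_tac].
  by same_edge bl2.
by same_edge bl3.
Qed.

(** Join one vertex to three disjoint pairs: two of the three edges share a colour and form a path
    of length 2, to which [lpath_lcycle_or] applies. *)
Lemma lcycle3_ramsey2 V : s = 2 -> 7 <= #|V| ->
  has_lcycle true 3 V \/ has_lcycle false 3 V.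
Proof.
move=> s2 leV; have [x xV] : exists x, x \in V by apply: ex_mem; nlia.
have cVx : #|V :\ x|.+1 = #|V| by rewrite [RHS](cardsD1 x) xV.
have [|A1 A1V cA1] := @ex_subset _ (V :\ x) 2; first by nlia.
have cV1 := cardD_sub A1V.
have [|A2 A2V cA2] := @ex_subset _ (V :\ x :\: A1) 2; first by nlia.
have cV2 := cardD_sub A2V.
have [|A3 A3V cA3] := @ex_subset _ (V :\ x :\: A1 :\: A2) 2; first by nlia.
have star b X Y : X \subset V :\ x -> Y \subset V :\ x -> [disjoint X & Y] ->
    #|X| = 2 -> #|Y| = 2 -> c (x |: X) = b -> c (x |: Y) = b ->
    has_lcycle b 3 V \/ has_lcycle (~~ b) 3 V.
  move=> XV YV XY cX cY cxX cxY; apply: lpath_lcycle_or => //.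
  have [y yX] : exists y, y \in X by apply: ex_mem; rewrite cX.
  have [z zY] : exists z, z \in Y by apply: ex_mem; rewrite cY.
  exists y, z, ((x |: X) :|: (x |: Y)); split; last by set_tac.
  have eX : edge b (x |: X) by apply: edge_intro => //; rewrite card1U ?cX ?s2 //; set_tac.
  have eY : edge b (x |: Y) by apply: edge_intro => //; rewrite card1U ?cY ?s2 //; set_tac.
  by apply: (@lpath_rcons _ _ _ _ _ _ x) eY _ _ _; [apply: lpath1 => //|..]; set_tac.
have star' X Y : X \subset V :\ x -> Y \subset V :\ x -> [disjoint X & Y] ->
    #|X| = 2 -> #|Y| = 2 -> c (x |: X) = c (x |: Y) ->
    has_lcycle true 3 V \/ has_lcycle false 3 V.
  move=> XV YV XY cX cY exy.
  have := star _ X Y XV YV XY cX cY exy erefl.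
  by case: (c (x |: Y)) => // -[]; [right|left].
case e1: (c (x |: A1)); case e2: (c (x |: A2)); case e3: (c (x |: A3)).
all: try by apply: (star' A1 A2) => //; [set_tac|set_tac|rewrite e1 e2].
all: try by apply: (star' A1 A3) => //; [set_tac|set_tac|rewrite e1 e3].
all: by apply: (star' A2 A3) => //; [set_tac|set_tac|set_tac|rewrite e2 e3].
Qed.

Theorem lcycle_ramsey n V : 3 <= n -> s * n + 1 <= #|V| ->
  has_lcycle true n V \/ has_lcycle false 3 V.
Proof.
elim/ltn_ind: n V => n IH V0 n3 leV0.
have [|V VV0 cV] := @ex_subset _ V0 (s * n + 1); first by [].
suff : has_lcycle true n V \/ has_lcycle false 3 V.
  by case=> h; [left|right]; apply: has_lcycleS h.
clear V0 leV0 VV0; apply: NNPP => nor.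
have no_red : ~ has_lcycle true n V by move=> h; apply: nor; left.
have no_blue : ~ has_lcycle false 3 V by move=> h; apply: nor; right.
(* Induction gives a red cycle of length m, which [lcycle_lpath] turns into a path. *)
have path m U : 3 <= m < n -> U \subset V -> s * m + 2 <= #|U| -> has_lpath true m U.
  case/andP=> m3 mn UV leU.
  have [||/(has_lcycleS UV)//] := IH m mn U m3; first by nlia.
  by case/(lcycle_lpath s_gt1 m3 leU) => // /(has_lcycleS UV).
have [s2|s_neq2] := eqVneq s 2.
  have [n_eq3|n_neq3] := eqVneq n 3.
    by apply: nor; rewrite n_eq3; apply: lcycle3_ramsey2 => //; rewrite cV s2 n_eq3.
  case: n n3 n_neq3 {IH} nor no_red path cV => [|n] // n3 n_neq3 nor no_red path cV.
  (* For s = 2 a red path one edge shorter than the cycle is closed directly. *)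
  apply: nor; apply: lpath_lcycle_or => //; first by rewrite cV s2; nlia.
  apply: path => //; last by rewrite cV s2; nlia.
  by rewrite ltnSn andbT; move: n3; rewrite leq_eqVlt eq_sym (negbTE n_neq3).
have s3 : 2 < s by rewrite ltn_neqAle eq_sym s_neq2.
have le3n : s * 3 <= s * n by rewrite leq_mul2l n3 orbT.
(* Both colours occur, since a monochromatic [V] contains every cycle that fits. A chain of
   exchanges from a red to a blue edge then yields [K], [a] and [d]. *)
have [E0 E0V eE0] : exists2 E : {set T}, E \subset V & edge true E.
  apply: NNPP => no_E; apply: no_blue; apply: lcycle_complete => //; last by nlia.
  move=> E EV cE; apply/negPn/negP => /(edgeN cE) eE.
  by apply: no_E; exists E.
have [E1 E1V eE1] : exists2 E : {set T}, E \subset V & edge false E.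
  apply: NNPP => no_E; case: n n3 {IH} cV no_red le3n {nor path} => [|[|n]] // n3 cV no_red le3n.
  apply: no_red; apply: lcycle_complete => //; last by nlia.
  move=> E EV cE; apply/negPn/negP => /(edgeN cE) eE.
  by apply: no_E; exists E.
have [|K [a [d [[aK dK ad] aKV dKV cK /andP[red_aK nred_dK]]]]] := ex_exchange E0V E1V _ eE0 (edge_excl eE1).
  by rewrite (edge_card eE0) (edge_card eE1).
have {}cK : #|K| = s by move: cK; rewrite (edge_card eE0) => -[].
have cdK : #|d |: K| = s.+1 by rewrite card1U ?cK.
have blue_dK := edgeN cdK nred_dK.
pose O := V :\: (a |: (d |: K)).
have cO : #|O| + s + 1 = s * n.
  have : a |: (d |: K) \subset V by set_tac.
  by move/cardD_sub; rewrite -/O card1U ?cdK; [nlia|set_tac].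
have aO : a \notin O by rewrite /O; set_tac.
have dO : d \notin O by rewrite /O; set_tac.
have OK : [disjoint O & K] by rewrite /O; set_tac.
have aV : a \in V by set_tac.
have dV : d \in V by set_tac.
have KV : K \subset V by set_tac.
have OV : O \subset V by rewrite /O; set_tac.
have [/existsP[p /existsP[X /and4P[pK XO /eqP cX blue_pX]]]|all_red] :=
  boolP [exists p, exists X : {set T}, [&& p \in K, X \subset O, #|X| == s & edge false (p |: X)]].
  have [n_eq3|n_neq3] := eqVneq n 3.
    exact: (some_blue_false3 s_gt1 aK dK ad aO dO OK aV dV KV OV cK cO
      red_aK blue_dK no_red no_blue s3 pK XO cX blue_pX n_eq3).
  have [n45|n_neq45] := boolP ((n == 4) || (n == 5)).
    exact: (some_blue_false45 s_gt1 aK dK ad aO dO OK aV dV KV OV cK cO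
      red_aK blue_dK no_red no_blue s3 pK XO cX blue_pX n45).
  have [m En] : exists m, n = m.+3 by exists (n - 3); nlia.
  have m3 : 3 <= m by move: n_neq45 n_neq3; rewrite En; case: m {En} => [|[|[|m]]].
  apply: (some_blue_false6 s_gt1 aK dK ad aO dO OK aV dV KV OV cK cO
      red_aK blue_dK no_red no_blue s3 pK XO cX blue_pX En m3).
  by move=> U UV; apply: path => //; rewrite m3 En; nlia.
apply: (all_red_false s_gt1 aK dK ad aO dO OK aV dV KV OV cK cO
      red_aK blue_dK no_red no_blue _ n3).
  move=> k Y kK YO cY; apply/negPn/negP => /edgeN blue_kY.
  case/existsP: all_red; exists k; apply/existsP; exists Y.
  rewrite kK YO cY eqxx; apply: blue_kY.
  by rewrite card1U ?cY //; set_tac.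
(* [d |: O] has s(n-1) vertices, enough for the induction hypothesis at n-2. *)
move=> n5; have dOV : d |: O \subset V by set_tac.
have [m En] : exists m, n = m.+2 by exists n.-2; nlia.
have mlt : m < n by rewrite En.
have m3 : 3 <= m by move: n5; rewrite En.
have lem : s * m + 1 <= #|d |: O| by move: cO; rewrite card1U // En; nlia.
by rewrite En /=; have [|/(has_lcycleS dOV)] := IH m mlt (d |: O) m3 lem.
Qed.

Lemma lpath_lcycle_ramsey n V : 3 <= n -> s * n + 2 <= #|V| ->
  has_lpath true n V \/ has_lcycle false 3 V.
Proof.
move=> n3 leV; have [|h|] := @lcycle_ramsey n V n3; first by nlia.
  exact: lcycle_lpath h.
by right.
Qed.

End CycleRamsey.

(** * The upper bound for paths *)

Section PathRamsey.
Variables (T : finType) (s : nat) (c : {set T} -> bool).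
Hypothesis s_gt1 : 1 < s.
Implicit Types (b : bool) (n m : nat) (x y z : T) (A B E F G Q S U V W X Y Z : {set T}).
Local Notation edge := (edge s c).
Local Notation lpath := (lpath s c).
Local Notation has_lpath := (has_lpath s c).
Local Notation has_lcycle := (has_lcycle s c).

Lemma triangle_split b V : has_lcycle b 3 V -> exists x y z E1 E2 E3,
  [/\ [/\ edge b E1, edge b E2 & edge b E3],
      [/\ E1 :&: E3 = [set x], E2 :&: E3 = [set y] & E1 :&: E2 = [set z]],
      [/\ x != y, y != z & x != z] & [/\ E1 \subset V, E2 \subset V & E3 \subset V]].
Proof.
case=> U [x [y [W [E3 [pW xy e3 EW UE]]]]] UV.
case: pW => z [E1 [W1 [e1 xE1 xz [y' [E2 [W2 [e2 zE2 zy [ey W2y] [E2y W1E]]]]] [E1z WE]]]].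
subst y' W2; have yE2 : y \in E2 by set_tac.
exists x, y, z, E1, E2, E3; split=> //.
- by split; subst W W1; set_tac.
- by split; [|rewrite eq_sym|].
- by split; subst W W1; set_tac.
Qed.

(** Otherwise [F], [G] and [r |: S] would be a path of length 3 in colour [b]. *)
Lemma edge_after_path2 b F G u r S V : edge b F -> edge b G -> F :&: G = [set u] ->
    r \in G -> r != u -> [disjoint S & F] -> [disjoint S & G] -> #|S| = s ->
    F \subset V -> G \subset V -> S \subset V -> ~ has_lpath b 3 V ->
  edge (~~ b) (r |: S).
Proof.
move=> eF eG FG rG ru SF SG cS FV GV SV nopath.
have [q qF] : exists q, q \in F :\ u.
  by apply: ex_mem; have := edge_card eF; rewrite (cardsD1 u); nlia.
have qu : q != u by set_tac.
case: (@lpath_extend _ s c s_gt1 b 1 q u r F G S V) => //; try set_tac.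
by apply: lpath1 => //; set_tac.
Qed.

Theorem lpath_ramsey n V : 3 <= n -> s * n + 2 <= #|V| ->
  has_lpath true n V \/ has_lpath false 3 V.
Proof.
elim/ltn_ind: n V => n IH V n3 leV; apply: NNPP => nor.
have no_red : ~ has_lpath true n V by move=> h; apply: nor; left.
have no_blue : ~ has_lpath false 3 V by move=> h; apply: nor; right.
have [|] := lpath_lcycle_ramsey c s_gt1 n3 leV; first by [].
case/triangle_split => x [y [z [E1 [E2 [E3 [[e1 e2 e3] [E13 E23 E12] [xy yz xz] [E1V E2V E3V]]]]]]].
pose I1 := E1 :\ x :\ z; pose I2 := E2 :\ y :\ z; pose I3 := E3 :\ x :\ y.
have cI E u v : edge false E -> u \in E -> v \in E -> u != v -> #|E :\ u :\ v| = s.-1.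
  move=> eE uE vE uv; have := edge_card eE.
  by rewrite (cardsD1 u) uE (cardsD1 v) !inE eq_sym uv vE; nlia.
have cI1 : #|I1| = s.-1 by apply: cI => //; set_tac.
have cI2 : #|I2| = s.-1 by apply: cI => //; set_tac.
have cI3 : #|I3| = s.-1 by apply: cI => //; set_tac.
pose R := V :\: (E1 :|: E2 :|: E3).
have cR : #|R| + 3 * s = #|V|.
  have EV : E1 :|: E2 :|: E3 \subset V by set_tac.
  rewrite -(cardD_sub EV) -/R; congr (_ + _).
  have -> : E1 :|: E2 :|: E3 = x |: (y |: (z |: (I1 :|: (I2 :|: I3)))).
    by rewrite /I1 /I2 /I3; set_tac.
  rewrite !card1U ?cardU_disjoint ?cI1 ?cI2 ?cI3;
    try by rewrite /I1 /I2 /I3; set_tac.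
  by nlia.
have red_y S : S \subset R -> #|S| = s -> edge true (y |: S).
  move=> SR cS.
  by apply: (edge_after_path2 e1 e3 E13 _ _ _ _ cS E1V E3V _ no_blue); rewrite /R in SR; set_tac.
have red_z S : S \subset R -> #|S| = s -> edge true (z |: S).
  move=> SR cS; rewrite setIC in E23.
  by apply: (edge_after_path2 e3 e2 E23 _ _ _ _ cS E3V E2V _ no_blue); rewrite /R in SR; set_tac.
have ext m u a d U : lpath true m u a U -> U \subset R -> d \in R -> d \notin U ->
    exists W, [/\ lpath true m.+3 u y W, W \subset V & W :&: R = d |: U /\ z \notin W].
  move=> pU UR dR dU; have aU := lpath_end pU; rewrite /R in UR dR.
  have r1 : edge true (x |: (a |: I1)).
    apply: (edge_after_path2 e2 e3 E23 _ _ _ _ _ E2V E3V _ no_blue); rewrite /I1; try set_tac.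
    by rewrite card1U; [rewrite -/I1; nlia|set_tac].
  have r2 : edge true (x |: (d |: I3)).
    have E21 : E2 :&: E1 = [set z] by rewrite setIC.
    apply: (edge_after_path2 e2 e1 E21 _ _ _ _ _ E2V E1V _ no_blue); rewrite /I3; try set_tac.
    by rewrite card1U; [rewrite -/I3; nlia|set_tac].
  have r3 : edge true (y |: (d |: I2)).
    apply: (edge_after_path2 e1 e3 E13 _ _ _ _ _ E1V E3V _ no_blue); rewrite /I2; try set_tac.
    by rewrite card1U; [rewrite -/I2; nlia|set_tac].
  have p1 : lpath true m.+1 u x (U :|: (x |: (a |: I1))).
    by apply: lpath_rcons pU r1 _ _ _; rewrite /I1; set_tac.
  have p2 : lpath true m.+2 u d (U :|: (x |: (a |: I1)) :|: (x |: (d |: I3))).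
    by apply: lpath_rcons p1 r2 _ _ _; rewrite /I1 /I3; set_tac.
  have p3 : lpath true m.+3 u y (U :|: (x |: (a |: I1)) :|: (x |: (d |: I3)) :|: (y |: (d |: I2))).
    by apply: lpath_rcons p2 r3 _ _ _; rewrite /I1 /I2 /I3; set_tac.
  eexists; split; [exact: p3|rewrite /I1 /I2 /I3; set_tac|split].
    by rewrite /R /I1 /I2 /I3; set_tac.
  by rewrite /I1 /I2 /I3; set_tac.
have yR : y \notin R by rewrite /R; set_tac.
have RV : R \subset V by rewrite /R; set_tac.
case: n n3 IH leV no_red {nor} => [|[|[|n]]] // _ IH leV no_red.
have cRn : s * n + 2 <= #|R| by nlia.
(* Here [n] is the original length minus 3. If it is at least 3, induction gives a red path in [R]
   that misses some [d] of [R], and [ext] adds the three missing edges. *)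
have [n_lt3|n_ge3] := ltnP n 3; last first.
  have [|[u [a [U [pU UR]]]]|] := IH n _ R n_ge3 cRn; first by nlia.
    have [|d dR dU] := @ex_notin _ R U; first by rewrite (lpath_card pU); nlia.
    have [W [pW WV _]] := ext _ _ _ _ _ pU UR dR dU.
    by apply: no_red; exists u, y, W.
  by move/(has_lpathS RV).
have [a [d [aR dR ad]]] : exists x y, [/\ x \in R, y \in R & x != y].
  by apply: ex_two; nlia.
have aRs : [set a] \subset R by set_tac.
have da : d \notin [set a] by set_tac.
(* For lengths 3, 4 and 5 start from the trivial path at [a]; after [ext], append [y |: S] and then
   [z |: (e |: S')] as needed. *)
have [W [pW WV [WR zW]]] := @ext 0 a a d [set a] (conj erefl erefl) aRs dR da.
have yW := lpath_end pW.
have cRad : #|R :\ a :\ d|.+2 = #|R|.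
  by rewrite [RHS](cardsD1 a) aR (cardsD1 d (R :\ a)) in_setD1 eq_sym ad dR.
case: n n_lt3 leV cRn no_red {IH} => [|n] n_lt3 leV cRn no_red.
  by apply: no_red; exists a, y, W.
have [|S SR cS] := @ex_subset _ (R :\ a :\ d) s; first by nlia.
have [e eS] : exists e, e \in S by apply: ex_mem; nlia.
have SR' : S \subset R by set_tac.
have SW : [disjoint S & W] by set_tac.
have ey : e != y by set_tac.
have pW4 : lpath true 4 a e (W :|: (y |: S)).
  by apply: lpath_rcons pW (red_y S SR' cS) _ _ _; set_tac.
case: n n_lt3 leV cRn no_red => [|[|n]] // _ leV cRn no_red.
  by apply: no_red; exists a, e, (W :|: (y |: S)); split=> //; set_tac.
have cRS := cardD_sub SR.
have [|S' S'R cS'] := @ex_subset _ (R :\ a :\ d :\: S) s.-1; first by nlia.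
have zR : z \notin R by rewrite /R; set_tac.
have zS : z \notin S by set_tac.
have zy : z != y by rewrite eq_sym.
have red5 : edge true (z |: (e |: S')).
  by apply: red_z; [set_tac|rewrite card1U ?cS'; [nlia|set_tac]].
apply: no_red; exists a, z, (W :|: (y |: S) :|: (z |: (e |: S'))); split.
  by apply: lpath_rcons pW4 red5 _ _ _; set_tac.
have zV : z \in V by set_tac.
by set_tac.
Qed.

End PathRamsey.

(** * Copies of hypergraphs *)

Section Sequences.
Variables (T : finType) (s : nat) (c : {set T} -> bool).
Implicit Types (b : bool) (n : nat) (x y z : T) (A B E U V W : {set T}).
Local Notation edge := (edge s c).
Local Notation lpath := (lpath s c).
Local Notation lcycle := (lcycle s c).

Definition window (w : seq T) i j : {set T} := [set t in w | i <= index t w <= j].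

(** List the first edge without its joint, with [x] in front, and then the rest, which begins with
    the joint. So each edge adds s positions and consecutive windows overlap in one. *)
Lemma lpath_seq b n x y U : lpath b n x y U -> exists w,
  [/\ uniq w, w =i U, index x w = 0, index y w = n * s &
      forall i, i < n -> edge b (window w (i * s) (i.+1 * s))].
Proof.
elim: n x U => [|n IH] x U.
  case=> <- ->; exists [:: x]; split=> //=; try by rewrite eqxx.
  by move=> t; rewrite !inE.
case=> z [E [W [eE xE xz pW [EW UE]]]]; have zW := lpath_start pW.
have [w [uw wW iz iy ew]] := IH _ _ pW.
have zE : z \in E by set_tac.
pose p := x :: enum (E :\ x :\ z).
have mem_p (t : T) : (t \in p) = (t \in E :\ z).
  by rewrite inE mem_enum !inE; case: eqVneq => [->|]; rewrite ?xz ?xE ?andbF.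
have size_p : size p = s.
  rewrite /= -cardE; have := edge_card eE.
  by rewrite (cardsD1 x) xE (cardsD1 z) in_setD1 eq_sym xz zE => -[].
have up : uniq p by rewrite /= mem_enum enum_uniq !inE eqxx !andbF.
have pw (t : T) : t \in p -> t \notin w.
  by rewrite mem_p wW => tp; apply: contraTN tp => tW; set_tac.
have idx (t : T) : index t (p ++ w) = if t \in p then index t p else s + index t w.
  by rewrite index_cat size_p.
have yw : y \in w by rewrite wW (lpath_end pW).
have yp : y \notin p by apply: contraL yw => /pw.
exists (p ++ w); split.
- rewrite cat_uniq up uw andbT /=; apply/hasPn => t tw.
  by apply: contraL tw => /pw.
- have -> : U = (E :\ z) :|: W by set_tac.
  by move=> t; rewrite mem_cat mem_p wW in_setU.
- by rewrite /= eqxx.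
- by rewrite idx (negbTE yp) iy mulSn.
case=> [|i] ltin.
  suff -> : window (p ++ w) (0 * s) (1 * s) = E by [].
  apply/setP => t; rewrite inE mem_cat idx mul1n mul0n leq0n /=.
  case: ifP => tp.
    have itp : index t p < s by rewrite -size_p index_mem.
    by move: tp; rewrite mem_p in_setD1 => /andP[_ ->]; rewrite ltnW.
  rewrite /= -{2}[s]addn0 leq_add2l leqn0 -iz.
  move: tp; rewrite mem_p !inE.
  have [-> _|tz] := eqVneq t z; first by rewrite wW zW eqxx zE.
  move=> /= ->; apply/negbTE/negP => /andP[tw /eqP].
  have zw : z \in w by rewrite wW.
  by move/(congr1 (nth z w)); rewrite !nth_index // => ?; case/eqP: tz.
have := ew i ltin; congr (edge b _); apply/setP => t.
rewrite [in LHS]inE [in RHS]inE mem_cat idx; case: ifP => tp.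
  have tw : t \notin w by apply: pw.
  have itp : index t p < s by rewrite -size_p index_mem.
  rewrite (negbTE tw) orbF; apply/esym/negbTE/negP => /andP[_ /andP[le_s _]].
  by move: le_s; rewrite leqNgt mulSn (leq_trans itp) ?leq_addr.
by rewrite orFb (mulSn i.+1) (mulSn i) !leq_add2l.
Qed.

(** The inner vertices of the closing edge are listed after [y], so this edge fills the tail of the
    list and wraps round to position 0. *)
Lemma lcycle_seq b n U : lcycle b n.+1 U -> exists w,
  [/\ uniq w, w =i U, forall i, i < n -> edge b (window w (i * s) (i.+1 * s)) &
      edge b [set t in w | (n * s <= index t w) || (index t w == 0)]].
Proof.
case=> x [y [W [E [pW xy eE EW UE]]]].
have xW := lpath_start pW; have yW := lpath_end pW; have cW := lpath_card pW.
have [w [uw wW ix iy ew]] := lpath_seq pW.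
have size_w : size w = (n * s).+1.
  by rewrite mulnC -cW -(card_uniqP uw); apply: eq_card.
pose p := enum (E :\: W).
have idx (t : T) : index t (w ++ p) = if t \in w then index t w else (n * s).+1 + index t p.
  by rewrite index_cat size_w.
exists (w ++ p); split.
- rewrite cat_uniq uw enum_uniq andbT; apply/hasPn => t.
  by rewrite mem_enum inE wW => /andP[].
- have -> : U = W :|: (E :\: W) by set_tac.
  by move=> t; rewrite mem_cat mem_enum wW in_setU.
- move=> i ltin; have := ew i ltin; congr (edge b _); apply/setP => t.
  rewrite [in LHS]inE [in RHS]inE mem_cat idx; case: ifP => // tw.
  apply/esym/negbTE/negP => /andP[_ /andP[_ /(leq_trans (leq_addr _ _))]].
  by rewrite ltnNge leq_mul2r ltin orbT.
suff -> : [set t in w ++ p | (n * s <= index t (w ++ p)) || (index t (w ++ p) == 0)] = E by [].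
apply/setP => t; rewrite inE mem_cat idx mem_enum in_setD -wW; case: ifP => tw /=.
  have /setP/(_ t) := EW; rewrite !inE -wW tw andbT => ->.
  have -> : (n * s <= index t w) = (t == y).
    have lt_t : index t w < (n * s).+1 by rewrite -size_w index_mem.
    rewrite -iy in lt_t *; apply/idP/eqP => [le_t|->//].
    have : index t w = index y w by apply/eqP; rewrite eqn_leq -ltnS lt_t.
    by move/(congr1 (nth x w)); rewrite !nth_index ?wW // -wW.
  have -> : (index t w == 0) = (t == x); last by rewrite orbC.
  apply/eqP/eqP => [|->//]; rewrite -ix => /(congr1 (nth x w)).
  by rewrite !nth_index ?wW // -wW.
by rewrite (leq_trans (leqnSn _)) ?leq_addr ?andbT.
Qed.

End Sequences.

(** * Copies of loose paths and cycles in a colour class *)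

Section Copies.
Variables (s N : nat) (c : {set 'I_N} -> bool).
Hypothesis s_gt1 : 1 < s.
Implicit Types (b : bool) (n : nat) (x y z : 'I_N) (U V : {set 'I_N}).

Lemma has_lpath_copy b n V : has_lpath s c b n V ->
  contains_copy (@colour_class (complete_hypergraph s.+1 N) c b) (loose_path s.+1 n).
Proof.
case=> x [y [U [pU UV]]]; have [w [uw wU ix iy ew]] := lpath_seq pU.
have size_w : size w = (n * s).+1.
  by rewrite mulnC -(lpath_card pU) -(card_uniqP uw); apply: eq_card.
pose f (i : 'I_(n * s).+1) := nth x w i.
exists f => [i j /eqP|e /imsetP[i _ ->]].
  by rewrite /f nth_uniq ?size_w // => /eqP /val_inj.
have /andP[cE /eqP rE] := ew i (ltn_ord i).
rewrite inE inE; suff -> : f @: loose_path_edge s.+1 i = window w (i * s) (i.+1 * s).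
  by rewrite cE rE eqxx.
apply/setP => t; apply/imsetP/idP => [[j]|].
  by rewrite !inE => jI ->; rewrite /f mem_nth ?size_w //= index_uniq ?size_w.
rewrite !inE => /andP[tw tI].
have it : index t w < (n * s).+1 by rewrite -size_w index_mem.
by exists (Ordinal it); rewrite ?inE // /f /= nth_index.
Qed.

(** The modulus matters only in the last edge, and there only for j = s, which wraps to vertex 0. *)
Lemma mem_loose_cycle_edge n (i : 'I_n.+2) (v : 'I_(n.+2 * s)) :
  (v \in loose_cycle_edge s.+1 i) =
    if i < n.+1 then i * s <= v <= i.+1 * s else (n.+1 * s <= v) || (v == 0 :> nat).
Proof.
have ltv := ltn_ord v; rewrite /= in ltv.
rewrite inE /=; apply/existsP/idP => [[j /eqP/= vj]|].
  have := ltn_ord j; rewrite ltnS => js; case: ifP => lti.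
    have : i.+2 * s <= n.+2 * s by rewrite leq_mul2r (lti : i.+1 < n.+2) orbT.
    move=> le_in; rewrite vj modn_small; last by rewrite !mulSn in le_in *; nlia.
    by rewrite leq_addr mulSn addnC leq_add2r.
  have Ei : i = n.+1 :> nat by apply/eqP; rewrite eqn_leq -ltnS ltn_ord leqNgt lti.
  rewrite vj Ei; move: js; rewrite leq_eqVlt => /orP[/eqP ->|js].
    by rewrite addnC -mulSn modnn orbT.
  by rewrite modn_small ?leq_addr // [n.+2 * s]mulSn addnC ltn_add2r.
case: ifP => lti.
  case/andP=> iv vi; have js : v - i * s < s.+1 by rewrite ltnS leq_subLR addnC -mulSn.
  by exists (Ordinal js); rewrite /= subnKC // modn_small.
have Ei : i = n.+1 :> nat by apply/eqP; rewrite eqn_leq -ltnS ltn_ord leqNgt lti.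
case/orP=> [le_v|/eqP v0].
  have js : v - n.+1 * s < s.+1 by rewrite ltnS leq_subLR addnC -mulSn ltnW.
  by exists (Ordinal js); rewrite /= Ei subnKC // modn_small.
by exists ord_max; rewrite /= Ei addnC -mulSn modnn v0.
Qed.

Lemma has_lcycle_copy b n V : has_lcycle s c b n.+2 V ->
  contains_copy (@colour_class (complete_hypergraph s.+1 N) c b) (loose_cycle s.+1 n.+2).
Proof.
case=> U cU UV.
have [w [uw wU ew ew']] := lcycle_seq cU.
have size_w : size w = n.+2 * s.
  have <- : #|U| = size w by rewrite -(card_uniqP uw); apply: esym; apply: eq_card.
  case: cU => x [y [W [E [pW xy eE EW ->]]]].
  have := cardsUI W E; rewrite [W :&: E]setIC EW cards2 xy.
  by rewrite (lpath_card pW) (edge_card eE); nlia.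
case: (cU) => x _.
pose f (i : 'I_(n.+2 * s)) := nth x w i.
exists f => [i j /eqP|e /imsetP[i _ ->]].
  by rewrite /f nth_uniq ?size_w // => /eqP /val_inj.
pose Q t := if i < n.+1 then i * s <= index t w <= i.+1 * s
            else (n.+1 * s <= index t w) || (index t w == 0).
have -> : f @: loose_cycle_edge s.+1 i = [set t in w | Q t].
  apply/setP => t; apply/imsetP/idP => [[j]|].
    by rewrite mem_loose_cycle_edge !inE => jI ->; rewrite /f mem_nth ?size_w //= /Q index_uniq ?size_w.
  rewrite !inE => /andP[tw tI].
  have it : index t w < n.+2 * s by rewrite -size_w index_mem.
  by exists (Ordinal it); rewrite ?mem_loose_cycle_edge // /f /= nth_index.
suff /andP[cE /eqP rE] : edge s c b [set t in w | Q t] by rewrite inE inE cE rE eqxx.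
by rewrite /Q; case: (i < n.+1) (ew i) => [|_ //]; apply.
Qed.

End Copies.

(* Colour an edge red when it misses a fixed vertex: a red copy of G avoids that
   vertex, while the edges of a blue copy of H share a vertex. *)
Lemma arrows_gt_card (k M : nat) (G H : hypergraph) (u0 : vertex G) (v0 : vertex H) :
    (forall u : vertex G, exists2 e, e \in edges G & u \in e) ->
    (forall v : vertex H, exists2 e, e \in edges H & v \notin e) ->
  arrows k M G H -> #|vertex G| < M.
Proof.
move=> coverG starH; case: M => [|M] arrGH.
  (* With no vertices to map to, [u0] and [v0] exclude both copies. *)
  by case: (arrGH xpredT) => -[f _ _]; [case: (f u0)|case: (f v0)].
pose c (e : {set 'I_M.+1}) := ord0 \notin e.
case: (arrGH c) => -[f inj_f edge_f].
  have avoid u : f u \in [set~ (ord0 : 'I_M.+1)].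
    have [e eG ue] := coverG u; have := edge_f e eG.
    rewrite !inE eqb_id => /andP[_]; apply: contra => /eqP <-.
    exact: imset_f.
  have : f @: [set: vertex G] \subset [set~ (ord0 : 'I_M.+1)].
    by apply/subsetP => _ /imsetP[u _ ->].
  by move/subset_leq_card; rewrite card_imset // cardsT cardsC1 card_ord.
have root e : e \in edges H -> ord0 \in f @: e.
  by move=> eH; have := edge_f e eH; rewrite !inE /c => /andP[_]; rewrite eqbF_neg negbK.
(* By injectivity a single [v] is sent to [ord0]; it would lie in every edge of [H]. *)
have [e1 e1H _] := starH v0; have /imsetP[v _ fv] := root e1 e1H.
have [e eH ve] := starH v; have /imsetP[w we fw] := root e eH.
by move: ve; rewrite (inj_f v w) ?we // -fv.
Qed.

(** * Edges containing or missing a given vertex *)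

Lemma loose_path_cover s n (v : vertex (loose_path s.+1 n)) : 0 < s -> 0 < n ->
  exists2 e, e \in edges (loose_path s.+1 n) & v \in e.
Proof.
case: n v => // n v s0 _; have := ltn_ord v; rewrite /= ltnS => le_v.
(* The last vertex is treated apart, since its quotient by s is not the index of an edge. *)
have [lt_v|ge_v] := ltnP v (n.+1 * s); last first.
  exists (loose_path_edge s.+1 (@ord_max n)); first exact: imset_f.
  by rewrite inE /= le_v (leq_trans _ ge_v) ?leq_mul2r ?leqnSn ?orbT.
have lt_i : v %/ s < n.+1 by rewrite ltn_divLR.
exists (loose_path_edge s.+1 (Ordinal lt_i)); first exact: imset_f.
by rewrite inE /= leq_divM ltnW // ltn_ceil.
Qed.

Lemma loose_cycle_cover s n (v : vertex (loose_cycle s.+1 n.+2)) : 1 < s ->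
  exists2 e, e \in edges (loose_cycle s.+1 n.+2) & v \in e.
Proof.
move=> s_gt1; have s0 := ltnW s_gt1; have lt_i : v %/ s < n.+2 by rewrite ltn_divLR //; exact: ltn_ord.
exists (loose_cycle_edge s.+1 (Ordinal lt_i)); first exact: imset_f.
have le_v := leq_divM v s; have lt_v := ltn_ceil v s0.
rewrite mem_loose_cycle_edge //= le_v (ltnW lt_v).
case: ltnP => // le_i; rewrite (leq_trans _ le_v) //.
by rewrite leq_mul2r le_i orbT.
Qed.

(** The first and third edges are disjoint. *)
Lemma loose_path3_no_star s (v : vertex (loose_path s.+1 3)) : 0 < s ->
  exists2 e, e \in edges (loose_path s.+1 3) & v \notin e.
Proof.
move=> s0; have [lt_v|ge_v] := ltnP s v.
  exists (loose_path_edge s.+1 (@Ordinal 3 0 isT)); first exact: imset_f.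
  by rewrite inE /= ?mul0n mul1n leqNgt lt_v.
exists (loose_path_edge s.+1 (@Ordinal 3 2 isT)); first exact: imset_f.
by rewrite inE /= negb_and -ltnNge mul2n -addnn (leq_ltn_trans ge_v) // -addn1 leq_add2l.
Qed.

(** Edges 0 and 1 share only the vertex s, which edge 2 misses. *)
Lemma loose_cycle3_no_star s (v : vertex (loose_cycle s.+1 3)) : 1 < s ->
  exists2 e, e \in edges (loose_cycle s.+1 3) & v \notin e.
Proof.
move=> s_gt1; have [lt_v|ge_v] := ltnP s v.
  exists (loose_cycle_edge s.+1 (@Ordinal 3 0 isT)); first exact: imset_f.
  by rewrite mem_loose_cycle_edge //= ?mul0n mul1n leqNgt lt_v.
have [lt_v|ge_v'] := ltnP v s.
  exists (loose_cycle_edge s.+1 (@Ordinal 3 1 isT)); first exact: imset_f.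
  by rewrite mem_loose_cycle_edge //= mul1n leqNgt lt_v.
exists (loose_cycle_edge s.+1 (@Ordinal 3 2 isT)); first exact: imset_f.
rewrite mem_loose_cycle_edge //= (_ : nat_of_ord v = s); first by lia.
by apply/eqP; rewrite eqn_leq ge_v.
Qed.

Theorem theorem4p8 (k n : nat) (hk : 3 <= k) (hn : 3 <= n) :
  [/\ is_ramsey_number k (loose_path k n) (loose_path k 3) (k.-1 * n + 2),
      is_ramsey_number k (loose_path k n) (loose_cycle k 3) (k.-1 * n + 2)
    & exists2 r, is_ramsey_number k (loose_cycle k n) (loose_cycle k 3) r
               & r + 1 = k.-1 * n + 2].
Proof.
case: k hk => // s s_gt1; rewrite ltnS in s_gt1; rewrite [s.+1.-1]/=.
have s0 : 0 < s := ltnW s_gt1; have n0 : 0 < n by apply: leq_trans hn.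
have sn0 : 0 < n * s by rewrite muln_gt0 n0.
have s30 : 0 < 3 * s by rewrite muln_gt0.
case: n hn n0 sn0 => [|[|n]] // n3 _ sn0.
(* Each lower bound is one more than the number of vertices of the red graph, which is sn+1 for the
   path and sn for the cycle. *)
split; [split|split|exists (s * n.+2 + 1); [split|by rewrite -addnA]].
- move=> c; have [|/has_lpath_copy|/has_lpath_copy] := @lpath_ramsey _ s c s_gt1 _ setT n3.
  + by rewrite cardsT card_ord.
  + by left.
  + by right.
- move=> M /(arrows_gt_card (ord0 : vertex (loose_path s.+1 n.+2)) (ord0 : vertex (loose_path s.+1 3))).
  rewrite card_ord => /= leM; rewrite addn2 mulnC; apply: leM => v.
    exact: loose_path_cover.
  exact: loose_path3_no_star.
- move=> c; have [|/has_lpath_copy|/(has_lcycle_copy s_gt1)] := @lpath_lcycle_ramsey _ s c s_gt1 _ setT n3.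
  + by rewrite cardsT card_ord.
  + by left.
  + by right.
- move=> M /(arrows_gt_card (ord0 : vertex (loose_path s.+1 n.+2)) (Ordinal s30 : vertex (loose_cycle s.+1 3))).
  rewrite card_ord => /= leM; rewrite addn2 mulnC; apply: leM => v.
    exact: loose_path_cover.
  exact: loose_cycle3_no_star.
- move=> c; have [|/(has_lcycle_copy s_gt1)|/(has_lcycle_copy s_gt1)] := @lcycle_ramsey _ s c s_gt1 _ setT n3.
  + by rewrite cardsT card_ord.
  + by left.
  + by right.
- move=> M /(arrows_gt_card (Ordinal sn0 : vertex (loose_cycle s.+1 n.+2)) (Ordinal s30 : vertex (loose_cycle s.+1 3))).
  rewrite card_ord => /= leM; rewrite addn1 mulnC; apply: leM => v.
    exact: loose_cycle_cover.
  exact: loose_cycle3_no_star.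
Qed.
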